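(* If $V=L$ holds, and there exist unfoldable and subtle cardinals, then the first unfoldable cardinal is bigger than $\pi^n_m$, for all $m$ and $n$.
   Context: $\mathcal{R}(\kappa)=V_\kappa$ is the set of all sets of rank less than $\kappa$. For structures $\mathfrak{A}=(M,E,\dots)$ and $\mathfrak{B}=(N,F,\dots)$ in the same language, $\mathfrak{B}$ is an end elementary extension (eee) of $\mathfrak{A}$, written $\mathfrak{A}\prec_e\mathfrak{B}$, if $\mathfrak{B}$ is a proper elementary extension of $\mathfrak{A}$ and for every $a\in M$, $\{b\in M : bEa\}=\{b\in N: bFa\}$. $o(M)$ denotes the ordinal height of $M$. A cardinal $\kappa$ is unfoldable if it is inaccessible and for every ordinal $\alpha$ and every $S\subset\mathcal{R}(\kappa)$ there is a well-founded eee $M$ of $(\mathcal{R}(\kappa),\in,S)$ with $o(M)\geq\alpha$. An inaccessible cardinal $\theta$ is subtle if for any sequence $(S_\alpha)_{\alpha<\theta}$ with each $S_\alpha\subset\alpha$ and any club $C\subset\theta$, there are $\beta<\gamma$, both in $C$, such that $S_\gamma\cap\beta=S_\beta$. $m,n$ range over natural numbers; $\pi^n_m$ denotes the first $\Pi^n_m$-indescribable cardinal, where $\kappa$ is $\Pi^n_m$-indescribable if for every $U\subset V_\kappa$ and every $\Pi^n_m$ sentence $\varphi$ (order-$(n+1)$ formulas with $m$ alternating blocks of quantifiers over the highest type, starting with universal) with $(V_\kappa,\in,U)\models\varphi$, there is $\alpha<\kappa$ with $(V_\alpha,\in,U\cap V_\alpha)\models\varphi$. *)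

(* Defs.v *)
From Stdlib Require Import PeanoNat.

Set Implicit Arguments.
Unset Strict Implicit.

(* A universe of sets satisfying ZFC.  Classes are Rocq predicates, so that
   Replacement is a single axiom quantified over all functional class
   relations; Separation and the existence of the empty set follow from it. *)
Record zfc_universe : Type := ZFC {
  sets :> Type;
  mem : sets -> sets -> Prop;
  extensionality : forall x y, (forall z, mem z x <-> mem z y) -> x = y;
  foundation : forall x, (exists y, mem y x) ->
    exists y, mem y x /\ forall z, mem z y -> ~ mem z x;
  pairing : forall a b, exists c, forall z, mem z c <-> z = a \/ z = b;
  union : forall a, exists u, forall z, mem z u <-> exists y, mem y a /\ mem z y;
  powerset : forall a, exists p,
    forall z, mem z p <-> forall y, mem y z -> mem y a;
  infinity : exists w,
    (exists e, mem e w /\ forall z, ~ mem z e) /\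
    (forall x, mem x w ->
       exists y, mem y w /\ forall z, mem z y <-> mem z x \/ z = x);
  replacement : forall (R : sets -> sets -> Prop) a,
    (forall x y y', mem x a -> R x y -> R x y' -> y = y') ->
    exists b, forall y, mem y b <-> exists x, mem x a /\ R x y;
  choice : forall a,
    (forall x, mem x a -> exists y, mem y x) ->
    (forall x y z, mem x a -> mem y a -> mem z x -> mem z y -> x = y) ->
    exists c, forall x, mem x a -> exists! y, mem y x /\ mem y c
}.

Arguments mem {_} _ _.
Notation "x ∈ y" := (mem x y) (at level 70, no associativity).
Notation "x ⊆ y" := (forall z, z ∈ x -> z ∈ y) (at level 70, no associativity).

Section Definitions.
Context {V : zfc_universe}.
Implicit Types (x y z a b α β γ δ κ θ A B C S U : V).

(* A set function with domain a is represented by a Rocq function V -> V, of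
   which only the values on a matter; by Replacement, every such function
   restricted to a set is a set. *)

(** ** Ordinals and cardinals *)

Definition transitive x := forall y, y ∈ x -> y ⊆ x.

Definition ordinal α := transitive α /\ forall β, β ∈ α -> transitive β.

Definition is_empty x := forall z, ~ z ∈ x.

Definition is_succ β α := forall z, z ∈ α <-> z ∈ β \/ z = β.

Definition limit α :=
  ordinal α /\ ~ is_empty α /\ ~ (exists β, is_succ β α).

Definition is_omega α := limit α /\ forall β, β ∈ α -> ~ limit β.

Definition is_power p a := forall z, z ∈ p <-> z ⊆ a.

Definition equinumerous a b := exists f : V -> V,
  (forall x, x ∈ a -> f x ∈ b) /\
  (forall x y, x ∈ a -> y ∈ a -> f x = f y -> x = y) /\
  (forall y, y ∈ b -> exists x, x ∈ a /\ f x = y).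

Definition cardinal κ :=
  ordinal κ /\ forall α, α ∈ κ -> ~ equinumerous α κ.

Definition uncountable κ := exists w, is_omega w /\ w ∈ κ.

Definition regular κ := limit κ /\
  forall α (f : V -> V), α ∈ κ -> (forall ξ, ξ ∈ α -> f ξ ∈ κ) ->
    exists β, β ∈ κ /\ forall ξ, ξ ∈ α -> f ξ ∈ β.

Definition strong_limit κ :=
  forall α p, α ∈ κ -> is_power p α -> exists β, β ∈ κ /\ equinumerous p β.

Definition inaccessible κ :=
  cardinal κ /\ uncountable κ /\ regular κ /\ strong_limit κ.

Definition least (P : V -> Prop) κ := P κ /\ forall α, α ∈ κ -> ~ P α.

(* rank x = ⋃ { rank y + 1 | y ∈ x } *)
Inductive has_rank : V -> V -> Prop :=
| has_rank_intro x α (f : V -> V) :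
    (forall y, y ∈ x -> has_rank y (f y)) ->
    (forall β, β ∈ α <-> exists y, y ∈ x /\ (β ∈ f y \/ β = f y)) ->
    has_rank x α.

(* The class of members of R(κ) = V_κ. *)
Definition in_R κ x := exists α, α ∈ κ /\ has_rank x α.

(** ** First-order logic *)

(* The language has equality, one binary and one unary predicate symbol;
   variables are named by natural numbers. *)
Inductive formula : Type :=
| Bot
| Eq (i j : nat)
| Rel (i j : nat)
| Pred (i : nat)
| Imp (φ ψ : formula)
| All (i : nat) (φ : formula).

Record structure : Type := Structure {
  carrier : V -> Prop;
  rel : V -> V -> Prop;
  pred : V -> Prop
}.
Implicit Types M N : structure.

Definition upd (e : nat -> V) i x : nat -> V :=
  fun j => if Nat.eqb j i then x else e j.

Fixpoint sat M (e : nat -> V) φ : Prop :=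
  match φ with
  | Bot => False
  | Eq i j => e i = e j
  | Rel i j => rel M (e i) (e j)
  | Pred i => pred M (e i)
  | Imp φ ψ => sat M e φ -> sat M e ψ
  | All i φ => forall x, carrier M x -> sat M (upd e i x) φ
  end.

Fixpoint free i φ : Prop :=
  match φ with
  | Bot => False
  | Eq j k | Rel j k => i = j \/ i = k
  | Pred j => i = j
  | Imp φ ψ => free i φ \/ free i ψ
  | All j φ => i <> j /\ free i φ
  end.

Definition elementary_extension M N :=
  (forall x, carrier M x -> carrier N x) /\
  forall φ e, (forall i, carrier M (e i)) -> (sat M e φ <-> sat N e φ).

Definition end_elementary_extension M N :=
  elementary_extension M N /\
  (exists b, carrier N b /\ ~ carrier M b) /\
  (forall a, carrier M a ->
     forall b, (carrier M b /\ rel M b a) <-> (carrier N b /\ rel N b a)).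

(** ** The constructible hierarchy *)

(* The unary predicate is interpreted by the empty set, so definability in
   this structure is definability in (A, ∈). *)
Definition mem_structure A := Structure (fun x => x ∈ A) mem (fun _ => False).

Definition definable_subset A x := x ⊆ A /\
  exists φ (e : nat -> V), (forall i, free i φ -> i <> 0 -> e i ∈ A) /\
    forall y, y ∈ A -> (y ∈ x <-> sat (mem_structure A) (upd e 0 y) φ).

(* Lset α A means A = L_α *)
Inductive Lset : V -> V -> Prop :=
| Lset_zero α A : is_empty α -> is_empty A -> Lset α A
| Lset_succ β α B A :
    is_succ β α -> Lset β B ->
    (forall x, x ∈ A <-> definable_subset B x) -> Lset α A
| Lset_limit α A (f : V -> V) :
    limit α -> (forall β, β ∈ α -> Lset β (f β)) ->
    (forall x, x ∈ A <-> exists β, β ∈ α /\ x ∈ f β) -> Lset α A.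

Definition constructible x := exists α A, ordinal α /\ Lset α A /\ x ∈ A.

(** ** Unfoldable cardinals *)

(* The structure (R(κ), ∈, S). *)
Definition R_structure κ S := Structure (in_R κ) mem (fun x => x ∈ S).

Definition set_sized M := exists m : V, forall x, carrier M x <-> x ∈ m.

Definition well_founded_structure M :=
  well_founded (fun x y => carrier M x /\ carrier M y /\ rel M x y).

(* M satisfies "x is transitive", resp. "x is an ordinal". *)
Definition transitive_in M x := forall y z, carrier M y -> carrier M z ->
  rel M y x -> rel M z y -> rel M z x.

Definition ordinal_in M x := carrier M x /\ transitive_in M x /\
  forall y, carrier M y -> rel M y x -> transitive_in M y.

(* o(M) = γ, for a well-founded model M of set theory: γ is the order type of
   the ordinals of M. *)
Definition height M γ := ordinal γ /\ exists h : V -> V,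
  (forall ξ, ξ ∈ γ -> ordinal_in M (h ξ)) /\
  (forall x, ordinal_in M x -> exists ξ, ξ ∈ γ /\ h ξ = x) /\
  (forall ξ η, ξ ∈ γ -> η ∈ γ -> (ξ ∈ η <-> rel M (h ξ) (h η))).

Definition unfoldable κ := inaccessible κ /\
  forall α S, ordinal α -> (forall x, x ∈ S -> in_R κ x) ->
    exists M, set_sized M /\ well_founded_structure M /\
      end_elementary_extension (R_structure κ S) M /\
      exists γ, height M γ /\ (α ∈ γ \/ α = γ).

(** ** Subtle cardinals *)

Definition unbounded_in C θ :=
  forall β, β ∈ θ -> exists γ, γ ∈ C /\ γ ∈ θ /\ β ∈ γ.

Definition club C θ := C ⊆ θ /\ unbounded_in C θ /\
  forall δ, δ ∈ θ -> limit δ -> unbounded_in C δ -> δ ∈ C.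

Definition subtle θ := inaccessible θ /\
  forall (S : V -> V) C, (forall α, α ∈ θ -> S α ⊆ α) -> club C θ ->
    exists β γ, β ∈ C /\ γ ∈ C /\ β ∈ γ /\
      forall ξ, (ξ ∈ S γ /\ ξ ∈ β) <-> ξ ∈ S β.

(** ** Higher-order logic and indescribability *)

(* A variable is given by its type k and its name i.  Type 0 ranges over the
   domain D, and type k+1 over the sets of objects of type k, so that
   formulas of order n+1 have variables of types at most n.  HMem is the
   relation of the structure, between objects of type 0; HIn k is
   membership of an object of type k in one of type k+1. *)
Inductive hformula : Type :=
| HBot
| HEq (k i j : nat)
| HMem (i j : nat)
| HIn (k i j : nat)
| HPred (i : nat)
| HImp (φ ψ : hformula)
| HAll (k i : nat) (φ : hformula).

Definition HEx k i φ := HImp (HAll k i (HImp φ HBot)) HBot.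

Fixpoint type_dom (D : V -> Prop) k x : Prop :=
  match k with
  | 0 => D x
  | S k' => forall y, y ∈ x -> type_dom D k' y
  end.

Definition hupd (e : nat -> nat -> V) k i x : nat -> nat -> V :=
  fun l j => if (Nat.eqb l k && Nat.eqb j i)%bool then x else e l j.

(* Satisfaction in (D, ∈, U). *)
Fixpoint hsat (D U : V -> Prop) (e : nat -> nat -> V) φ : Prop :=
  match φ with
  | HBot => False
  | HEq k i j => e k i = e k j
  | HMem i j => e 0 i ∈ e 0 j
  | HIn k i j => e k i ∈ e (S k) j
  | HPred i => U (e 0 i)
  | HImp φ ψ => hsat D U e φ -> hsat D U e ψ
  | HAll k i φ => forall x, type_dom D k x -> hsat D U (hupd e k i x) φ
  end.

Fixpoint hfree k i φ : Prop :=
  match φ with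
  | HBot => False
  | HEq l j1 j2 => k = l /\ (i = j1 \/ i = j2)
  | HMem j1 j2 => k = 0 /\ (i = j1 \/ i = j2)
  | HIn l j1 j2 => (k = l /\ i = j1) \/ (k = S l /\ i = j2)
  | HPred j => k = 0 /\ i = j
  | HImp φ ψ => hfree k i φ \/ hfree k i ψ
  | HAll l j φ => ~ (k = l /\ i = j) /\ hfree k i φ
  end.

Definition sentence φ := forall k i, ~ hfree k i φ.

Definition models (D U : V -> Prop) φ := forall e, hsat D U e φ.

(* All variables have type at most n and all quantified ones type below n. *)
Fixpoint matrix n φ : Prop :=
  match φ with
  | HBot => True
  | HEq k _ _ => k <= n
  | HMem _ _ => True
  | HIn k _ _ => S k <= n
  | HPred _ => True
  | HImp φ ψ => matrix n φ /\ matrix n ψ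
  | HAll k _ φ => k < n /\ matrix n φ
  end.

Definition quant (q : bool) k i φ := if q then HAll k i φ else HEx k i φ.

(* prenex n true m: m alternating nonempty blocks of quantifiers of type n,
   the first one universal, followed by a matrix; prenex n false m: the same
   with the first block existential. *)
Inductive prenex n : bool -> nat -> hformula -> Prop :=
| prenex_matrix q φ : matrix n φ -> prenex n q 0 φ
| prenex_new_block q m i φ :
    prenex n (negb q) m φ -> prenex n q (S m) (quant q n i φ)
| prenex_same_block q m i φ :
    prenex n q (S m) φ -> prenex n q (S m) (quant q n i φ).

Definition Pi_sentence n m φ := prenex n true m φ /\ sentence φ.

(* As usual in model theory, structures are nonempty, hence the condition on
   α.  It matters only for n = 0, as the empty structure satisfies every
   universal first-order sentence. *)
Definition indescribable n m κ := cardinal κ /\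
  forall (U : V), (forall x, x ∈ U -> in_R κ x) ->
  forall φ, Pi_sentence n m φ -> models (in_R κ) (fun x => x ∈ U) φ ->
    exists α, α ∈ κ /\ ~ is_empty α /\
      models (in_R α) (fun x => x ∈ U /\ in_R α x) φ.

(* κ = π^n_m *)
Definition first_indescribable n m κ := least (indescribable n m) κ.

End Definitions.

Definition V_equals_L (V : zfc_universe) := forall x : V, constructible x.

(* Main.v *)
Require Import Defs.
From Stdlib Require Import Classical ClassicalEpsilon FunctionalExtensionality.
From Stdlib Require Import Lia PeanoNat.
From Stdlib Require Cantor.

(** Let V = L and let κ be unfoldable.  The claim is that some cardinal below κ
    reflects every sentence whose quantifiers range over types below n, for any
    given n; as Π^n_m sentences only quantify over types below n + 1
    ([indescribable_above]), this puts every π^n_m below κ, in particular when κ is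
    the least unfoldable cardinal.

    An unfoldable cardinal yields, for every S ⊆ R(κ), a proper elementary end
    extension of (R(κ), ∈, S) of height as large as desired, and the Mostowski
    collapse makes it a transitive set (D, ∈, X) that still extends R(κ)
    ([transitive_extension]).  The key point is that S can be chosen so that D
    contains all objects of type below n over R(κ) ([constructible_extension]).
    Let S record, among other things, the sets L_δ for δ < κ and, for each member
    of L_(δ+1), the numbers of the formulas that define it over L_δ.  For each single
    formula, the assertion that its number is used correctly is first-order, so
    it passes to D.  Formulas are numbered by elements of ω, and ω gains no
    members in an end extension; hence no nonstandard formula appears in D and
    the recorded hierarchy is the true one for every ordinal of D
    ([L_recursion_correct]).  Satisfaction is thereby never formalized inside a
    model: every transfer concerns one formula at a time.  By V = L the objects
    of type below n over R(κ) occur in some L_δ, and D can be taken high enough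
    to include it.

    As D sees those types, it evaluates such sentences over R(κ) correctly.
    If (R(κ), ∈, U) satisfies one, then D satisfies that some R(α) does, and so
    does R(κ): the sentence reflects below κ ([reflection]).  Suppose now that no
    α < κ is indescribable.  Let S also record for every cardinal α < κ a
    counterexample, that is, a set U ⊆ R(α) and the number of a sentence true in
    (R(α), ∈, U) which does not reflect below α, and for every other ordinal
    α < κ a map onto α from a smaller ordinal.  By elementarity, D has such data for κ
    itself.  The regularity of κ excludes the map, so it is a counterexample; its
    sentence is again standard, it holds over R(κ) and does not reflect,
    contradicting the previous step ([unfoldable_above_indescribable]). *)

Set Implicit Arguments.
Unset Strict Implicit.

(** * Sets *)

Section SetTheory.
Context {V : zfc_universe}.
Implicit Types (x y z a b α β γ δ κ : V).

Lemma universe_inhabited : inhabited V.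
Proof. destruct (infinity V) as [w _]. exact (inhabits w). Qed.

Lemma choose_function (P : V -> Prop) (R : V -> V -> Prop) :
  (forall x, P x -> exists y, R x y) ->
  exists f : V -> V, forall x, P x -> R x (f x).
Proof.
  intros H. exists (fun x => epsilon universe_inhabited (R x)).
  intros x Hx. apply epsilon_spec. auto.
Qed.

Lemma separation (P : V -> Prop) a : exists b, forall z, z ∈ b <-> z ∈ a /\ P z.
Proof.
  destruct (@replacement V (fun x y => x = y /\ P x) a) as [b Hb].
  - intros x y y' _ [-> _] [-> _]. reflexivity.
  - exists b. intros z. rewrite Hb. split.
    + intros (x & Hx & -> & Hz). auto.
    + intros [Hz HP]. exists z. auto.
Qed.

Lemma function_image (f : V -> V) a :
  exists b, forall y, y ∈ b <-> exists x, x ∈ a /\ y = f x.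
Proof.
  destruct (@replacement V (fun x y => y = f x) a) as [b Hb].
  - intros; congruence.
  - exists b. exact Hb.
Qed.

Lemma indexed_union (f : V -> V) a :
  exists u, forall z, z ∈ u <-> exists x, x ∈ a /\ z ∈ f x.
Proof.
  destruct (function_image f a) as [b Hb]. destruct (union b) as [u Hu].
  exists u. intros z. rewrite Hu. split.
  - intros (y & Hy & Hz). apply Hb in Hy as (x & Hx & ->). eauto.
  - intros (x & Hx & Hz). exists (f x). rewrite Hb. eauto.
Qed.

Lemma empty_exists : exists a : V, is_empty a.
Proof. destruct (infinity V) as (w & (e & _ & He) & _). exists e. exact He. Qed.

Lemma empty_unique a b : is_empty a -> is_empty b -> a = b.
Proof. intros Ha Hb. apply extensionality. firstorder. Qed.

Lemma nonempty_member a : ~ is_empty a -> exists z, z ∈ a.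
Proof. intros H. apply NNPP. intros N. apply H. intros z Hz. eauto. Qed.

Definition is_pair c a b := forall z, z ∈ c <-> z = a \/ z = b.

Lemma succ_exists a : exists s, is_succ a s.
Proof.
  destruct (pairing a a) as [s Hs].
  destruct (pairing a s) as [p Hp]. destruct (union p) as [u Hu].
  exists u. intros z. rewrite Hu. split.
  - intros (y & Hy & Hz). apply Hp in Hy as [->| ->]; auto.
    apply Hs in Hz. tauto.
  - intros [Hz| ->].
    + exists a. rewrite Hp. auto.
    + exists s. rewrite Hp, Hs. auto.
Qed.

Lemma mem_irrefl x : ~ x ∈ x.
Proof.
  intros H. destruct (pairing x x) as [s Hs].
  destruct (foundation (x := s)) as (y & Hy & Hf).
  - exists x. apply Hs. auto.
  - assert (y = x) as -> by (apply Hs in Hy; tauto).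
    exact (Hf x H Hy).
Qed.

Lemma mem_asym x y : x ∈ y -> ~ y ∈ x.
Proof.
  intros H1 H2. destruct (pairing x y) as [s Hs].
  destruct (foundation (x := s)) as (z & Hz & Hf).
  - exists x. apply Hs. auto.
  - apply Hs in Hz as [->| ->].
    + apply (Hf y H2). apply Hs; auto.
    + apply (Hf x H1). apply Hs; auto.
Qed.

Lemma succ_unique a s s' : is_succ a s -> is_succ a s' -> s = s'.
Proof.
  intros H H'. apply extensionality. intros z. rewrite (H z), (H' z). tauto.
Qed.

Lemma succ_injective a b s : is_succ a s -> is_succ b s -> a = b.
Proof.
  intros Ha Hb.
  assert (A : a ∈ b \/ a = b) by (apply Hb, Ha; auto).
  assert (B : b ∈ a \/ b = a) by (apply Ha, Hb; auto).
  destruct A as [A|A]; auto. destruct B as [B|B]; auto.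
  destruct (mem_asym A B).
Qed.

Definition empty_set : V := epsilon universe_inhabited is_empty.
Definition succ a : V := epsilon universe_inhabited (is_succ a).

Lemma empty_set_spec : is_empty empty_set.
Proof. unfold empty_set. apply epsilon_spec, empty_exists. Qed.

Lemma succ_spec a : is_succ a (succ a).
Proof. unfold succ. apply epsilon_spec, succ_exists. Qed.

Lemma mem_succ z a : z ∈ succ a <-> z ∈ a \/ z = a.
Proof. apply succ_spec. Qed.

Fixpoint num (n : nat) : V :=
  match n with 0 => empty_set | S n => succ (num n) end.

Lemma num_lt i j : i < j -> num i ∈ num j.
Proof.
  induction 1; simpl; apply mem_succ; auto.
Qed.

Lemma num_injective i j : num i = num j -> i = j.
Proof.
  intros E. destruct (Nat.lt_trichotomy i j) as [H|[H|H]]; auto;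
    apply num_lt in H; rewrite E in H; destruct (mem_irrefl H).
Qed.

Lemma nums_in_a_set : exists w, forall n, num n ∈ w.
Proof.
  destruct (infinity V) as (w & (e & He & Hem) & Hs). exists w.
  induction n as [|n IH]; simpl.
  - rewrite (empty_unique empty_set_spec Hem). exact He.
  - destruct (Hs _ IH) as (y & Hy & Hy').
    rewrite (succ_unique (succ_spec (num n)) Hy'). exact Hy.
Qed.

(** Replacement speaks of arbitrary classes, so an external descending sequence
    has a set of values, against Foundation.  Hence ∈-induction holds for every
    predicate, not only for those definable in the universe. *)
Lemma mem_well_founded : well_founded (fun x y : V => x ∈ y).
Proof.
  intros x. apply NNPP. intros Hx.
  assert (step : forall y, ~ Acc (fun x y : V => x ∈ y) y ->
            exists z, z ∈ y /\ ~ Acc (fun x y : V => x ∈ y) z).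
  { intros y Hy. apply NNPP. intros N. apply Hy. constructor. intros z Hz.
    apply NNPP. intros Hn. apply N. eauto. }
  destruct (choose_function step) as [g Hg].
  set (f := fix f n := match n with 0 => x | S n => g (f n) end).
  assert (Hf : forall n, ~ Acc (fun x y : V => x ∈ y) (f n)).
  { induction n; simpl; auto. apply Hg; auto. }
  destruct nums_in_a_set as [w Hw].
  destruct (@replacement V (fun u v => exists n, u = num n /\ v = f n) w)
    as [b Hb].
  { intros u v v' _ (n & -> & ->) (n' & E & ->).
    apply num_injective in E. congruence. }
  destruct (foundation (x := b)) as (y & Hy & Hmin).
  { exists (f 0). apply Hb. exists (num 0). eauto. }
  apply Hb in Hy as (u & _ & n & -> & ->).
  apply (Hmin (f (S n))).
  - apply (Hg (f n)); auto.
  - apply Hb. exists (num (S n)). split; eauto.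
Qed.

Lemma minimal_element (P : V -> Prop) :
  (exists x, P x) -> exists x, P x /\ forall y, y ∈ x -> ~ P y.
Proof.
  intros [x Hx]. apply NNPP. intros N. revert Hx.
  induction x as [x IH] using (well_founded_ind mem_well_founded).
  intros Hx. apply N. exists x. split; auto. 
Qed.
End SetTheory.

(** * Ordinals and ranks *)

Section Ordinals.
Context {V : zfc_universe}.
Implicit Types (x y z a b α β γ δ κ : V).

Lemma ordinal_transitive α β γ : ordinal α -> β ∈ α -> γ ∈ β -> γ ∈ α.
Proof. intros [H _] Hb Hc. exact (H β Hb γ Hc). Qed.

Lemma ordinal_mem α β : ordinal α -> β ∈ α -> ordinal β.
Proof.
  intros Ho Hb. split.
  - apply Ho, Hb.
  - intros γ Hc. apply Ho. eapply ordinal_transitive; eauto.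
Qed.

Lemma ordinal_trichotomy α β :
  ordinal α -> ordinal β -> α ∈ β \/ α = β \/ β ∈ α.
Proof.
  revert β. induction α as [α IHα] using (well_founded_ind mem_well_founded).
  intros β. induction β as [β IHβ] using (well_founded_ind mem_well_founded).
  intros Ha Hb. apply NNPP. intros N.
  assert (E : α = β).
  { apply extensionality. intros z. split; intros Hz.
    - destruct (IHα z Hz β (ordinal_mem Ha Hz) Hb) as [H|[H|H]]; auto.
      + subst. tauto.
      + destruct N. right; right. eapply ordinal_transitive; eauto.
    - destruct (IHβ z Hz Ha (ordinal_mem Hb Hz)) as [H|[H|H]]; auto.
      + destruct N. left. eapply ordinal_transitive; eauto.
      + subst. tauto. }
  tauto.
Qed.

Lemma ordinal_subset α β :
  ordinal α -> ordinal β -> α ⊆ β -> α ∈ β \/ α = β.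
Proof.
  intros Ha Hb Hs. destruct (ordinal_trichotomy Ha Hb) as [H|[H|H]]; auto.
  destruct (mem_irrefl (Hs _ H)).
Qed.

Lemma ordinal_succ α : ordinal α -> ordinal (succ α).
Proof.
  intros Ha. split.
  - intros y Hy z Hz. apply mem_succ. left.
    apply mem_succ in Hy as [Hy| ->]; auto. eapply ordinal_transitive; eauto.
  - intros β Hb. destruct Ha as [Ht Hm].
    apply mem_succ in Hb as [Hb| ->]; auto.
Qed.

Lemma ordinal_bound (f : V -> V) a :
  (forall x, x ∈ a -> ordinal (f x)) ->
  exists σ, ordinal σ /\ forall x, x ∈ a -> f x ∈ σ.
Proof.
  intros H. destruct (indexed_union (fun x => succ (f x)) a) as [σ Hσ].
  exists σ. split; [split|].
  - intros y Hy z Hz. apply Hσ in Hy as (x & Hx & Hy). apply Hσ. exists x.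
    split; auto. eapply ordinal_transitive; eauto. apply ordinal_succ; auto.
  - intros β Hb. apply Hσ in Hb as (x & Hx & Hb).
    apply (ordinal_succ (H x Hx)), Hb.
  - intros x Hx. apply Hσ. exists x. split; auto. apply mem_succ; auto.
Qed.

Lemma ordinal_cases α :
  ordinal α -> is_empty α \/ (exists β, is_succ β α) \/ limit α.
Proof.
  intros H. destruct (classic (is_empty α)); auto.
  destruct (classic (exists β, is_succ β α)); auto.
  right; right. unfold limit. auto.
Qed.

Lemma limit_succ α β : limit α -> β ∈ α -> succ β ∈ α.
Proof.
  intros (Ho & _ & Hn) Hb.
  assert (Hbo := ordinal_mem Ho Hb).
  destruct (ordinal_trichotomy (ordinal_succ Hbo) Ho) as [H|[H|H]]; auto.
  - destruct Hn. exists β. rewrite <- H. apply succ_spec.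
  - apply mem_succ in H as [H| ->].
    + destruct (mem_asym H Hb).
    + destruct (mem_irrefl Hb).
Qed.

Lemma num_in_limit α n : limit α -> num n ∈ α.
Proof.
  intros H. induction n as [|n IH]; simpl.
  - destruct (minimal_element (P := fun x => x ∈ α)) as (x & Hx & Hm).
    { apply nonempty_member. apply H. }
    replace empty_set with x; auto. apply empty_unique; [|apply empty_set_spec].
    intros z Hz. apply (Hm z Hz). destruct H as [H _].
    eapply ordinal_transitive; eauto.
  - apply limit_succ; auto.
Qed.

(** Being well-founded from outside as well, the universe has no nonstandard
    natural numbers. *)
Lemma omega_standard w x : is_omega w -> x ∈ w -> exists n, x = num n.
Proof.
  intros [Hw Hl]. induction x as [x IH] using (well_founded_ind mem_well_founded).
  intros Hx. assert (Ho : ordinal x).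
  { eapply ordinal_mem; eauto. apply Hw. }
  destruct (ordinal_cases Ho) as [H|[[y H]|H]].
  - exists 0. apply empty_unique; auto. apply empty_set_spec.
  - assert (Hy : y ∈ x) by (apply H; auto).
    destruct (IH y Hy) as [n ->].
    { eapply ordinal_transitive; eauto. apply Hw. }
    exists (S n). simpl. apply (succ_unique H), succ_spec.
  - destruct (Hl x Hx H).
Qed.

(** Ranks are given by a relation; it is functional and total, which makes the
    function [rank] below available. *)
Lemma has_rank_unique x α β : has_rank x α -> has_rank x β -> α = β.
Proof.
  intros H. revert β. induction H as [x α f _ IH Hα].
  intros β Hb. destruct Hb as [x β g Hg Hβ].
  apply extensionality. intros z. rewrite Hα, Hβ.
  split; intros (y & Hy & H); exists y; rewrite (IH y Hy (g y) (Hg y Hy)) in *; auto.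
Qed.

Lemma has_rank_exists x : exists α, has_rank x α.
Proof.
  induction x as [x IH] using (well_founded_ind mem_well_founded).
  destruct (choose_function IH) as [f Hf].
  destruct (indexed_union (fun y => succ (f y)) x) as [u Hu].
  exists u. apply (has_rank_intro Hf). intros β. rewrite Hu.
  split; intros (y & Hy & H); exists y; rewrite mem_succ in *; auto.
Qed.

Definition rank x : V := epsilon universe_inhabited (has_rank x).

Lemma rank_spec x : has_rank x (rank x).
Proof. unfold rank. apply epsilon_spec, has_rank_exists. Qed.

Lemma rank_eq x α : has_rank x α -> rank x = α.
Proof. apply has_rank_unique, rank_spec. Qed.

Lemma mem_rank x β : β ∈ rank x <-> exists y, y ∈ x /\ β ∈ succ (rank y).
Proof.
  destruct (rank_spec x) as [x α f Hf Hα]. rewrite Hα.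
  split; intros (y & Hy & H); exists y; rewrite mem_succ in *;
    rewrite (rank_eq (Hf y Hy)) in *; auto.
Qed.

Lemma rank_mem x y : y ∈ x -> rank y ∈ rank x.
Proof. intros H. apply mem_rank. exists y. rewrite mem_succ. auto. Qed.

Lemma rank_ordinal x : ordinal (rank x).
Proof.
  induction x as [x IH] using (well_founded_ind mem_well_founded). split.
  - intros y Hy z Hz. apply mem_rank in Hy as (u & Hu & Hy). apply mem_rank.
    exists u. split; auto. eapply ordinal_transitive; eauto.
    apply ordinal_succ; auto.
  - intros β Hb. apply mem_rank in Hb as (u & Hu & Hb).
    apply (ordinal_succ (IH u Hu)), Hb.
Qed.

Lemma in_R_rank α x : in_R α x <-> rank x ∈ α.
Proof.
  split.
  - intros (β & Hb & Hr). rewrite (rank_eq Hr). exact Hb.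
  - intros H. exists (rank x). split; auto. apply rank_spec.
Qed.

Lemma rank_le x α :
  ordinal α -> (forall y, y ∈ x -> rank y ∈ α) -> rank x ∈ α \/ rank x = α.
Proof.
  intros Ha H. apply ordinal_subset; auto using rank_ordinal.
  intros β Hb. apply mem_rank in Hb as (y & Hy & Hb).
  apply mem_succ in Hb as [Hb| ->]; auto. eapply ordinal_transitive; eauto.
Qed.

Lemma rank_of_ordinal α : ordinal α -> rank α = α.
Proof.
  induction α as [α IH] using (well_founded_ind mem_well_founded). intros Ha.
  apply extensionality. intros β. rewrite mem_rank. split.
  - intros (y & Hy & Hb). rewrite (IH y Hy (ordinal_mem Ha Hy)) in Hb.
    apply mem_succ in Hb as [Hb| ->]; auto. eapply ordinal_transitive; eauto.
  - intros Hb. exists β. rewrite (IH β Hb (ordinal_mem Ha Hb)), mem_succ. auto.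
Qed.

Lemma in_R_ordinal α β : ordinal β -> (in_R α β <-> β ∈ α).
Proof. intros H. rewrite in_R_rank, rank_of_ordinal; tauto. Qed.

Lemma in_R_transitive α x y : ordinal α -> in_R α x -> y ∈ x -> in_R α y.
Proof.
  rewrite !in_R_rank. intros Ha Hx Hy.
  eapply ordinal_transitive; eauto using rank_mem.
Qed.

Lemma in_R_mono α β x : ordinal α -> β ∈ α -> in_R β x -> in_R α x.
Proof. rewrite !in_R_rank. apply ordinal_transitive. Qed.

Lemma in_R_step α β x :
  ordinal α -> β ∈ α -> (forall y, y ∈ x -> in_R β y) -> in_R α x.
Proof.
  intros Ha Hb H. apply in_R_rank.
  destruct (@rank_le x β) as [Hr| ->]; auto.
  - eapply ordinal_mem; eauto.
  - intros y Hy. apply in_R_rank; auto.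
  - eapply ordinal_transitive; eauto.
Qed.

Lemma in_R_recursion α x :
  ordinal α -> (in_R α x <-> exists β, β ∈ α /\ forall y, y ∈ x -> in_R β y).
Proof.
  intros Ha. split.
  - intros H. apply in_R_rank in H. exists (rank x). split; auto.
    intros y Hy. apply in_R_rank, rank_mem, Hy.
  - intros (β & Hb & H). eapply in_R_step; eauto.
Qed.

Lemma in_R_set α : ordinal α -> exists v, forall x, x ∈ v <-> in_R α x.
Proof.
  induction α as [α IH] using (well_founded_ind mem_well_founded). intros Ha.
  assert (H : forall β, β ∈ α -> exists p, forall x,
            x ∈ p <-> forall y, y ∈ x -> in_R β y).
  { intros β Hb. destruct (IH β Hb (ordinal_mem Ha Hb)) as [v Hv].
    destruct (powerset v) as [p Hp]. exists p. intros x. rewrite Hp.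
    split; intros H y Hy; apply Hv; auto. }
  destruct (choose_function H) as [f Hf].
  destruct (indexed_union f α) as [v Hv]. exists v. intros x.
  rewrite Hv, (in_R_recursion x Ha).
  split; intros (β & Hb & Hx); exists β; split; auto; apply (Hf β Hb); auto.
Qed.

Lemma in_R_pair κ a b c :
  limit κ -> in_R κ a -> in_R κ b -> is_pair c a b -> in_R κ c.
Proof.
  intros Hk Ha Hb Hc.
  assert (Ho : ordinal κ) by apply Hk.
  rewrite in_R_rank in Ha, Hb.
  assert (exists β, β ∈ κ /\ rank a ∈ β /\ rank b ∈ β) as (β & H & H1 & H2).
  { destruct (ordinal_trichotomy (rank_ordinal a) (rank_ordinal b)) as [H|[H|H]].
    - exists (succ (rank b)). rewrite !mem_succ. auto using limit_succ.
    - exists (succ (rank b)). rewrite !mem_succ. auto using limit_succ.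
    - exists (succ (rank a)). rewrite !mem_succ. auto using limit_succ. }
  apply (in_R_step Ho H). intros y Hy. apply in_R_rank.
  apply Hc in Hy as [->| ->]; auto.
Qed.

Lemma num_ordinal n : ordinal (num n : V).
Proof.
  induction n; simpl; auto using ordinal_succ.
  split; intros y Hy; destruct (empty_set_spec Hy).
Qed.

(** Each type adds at most one to the rank, so all types over R(α) stay below a
    limit ordinal above α. *)
Lemma type_dom_in_R κ α k x :
  limit κ -> α ∈ κ -> type_dom (in_R α) k x -> in_R κ x.
Proof.
  intros Hk Ha H.
  assert (exists β, β ∈ κ /\ in_R β x) as (β & Hb & Hx).
  { revert x H. enough (exists β, β ∈ κ /\ ordinal β /\
      forall x, type_dom (in_R α) k x -> in_R β x) as (β & ? & _ & ?) by eauto.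
    induction k as [|k (β & Hb & Hbo & IH)]; simpl.
    - exists α. split; [|split]; auto. apply (ordinal_mem (proj1 Hk) Ha).
    - exists (succ β). split; [|split]; auto using limit_succ, ordinal_succ.
      intros x Hx. apply (@in_R_step _ β).
      + apply ordinal_succ; auto.
      + apply mem_succ; auto.
      + auto. }
  eapply in_R_mono; eauto. apply Hk.
Qed.
End Ordinals.

(** * The constructible hierarchy *)

Section Constructible.
Context {V : zfc_universe}.
Implicit Types (x y z a b α β γ δ κ A B : V).

Lemma succ_not_empty β α : is_succ β α -> ~ is_empty α.
Proof. intros H He. apply (He β), H. auto. Qed.

(** The three clauses are mutually exclusive and the predecessor of a successor
    is unique, so the clause that applies is determined by α. *)
Lemma Lset_unique α A B : Lset α A -> Lset α B -> A = B.
Proof.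
  intros H. revert B.
  induction H as [α A Hα HA|α β A' A Hs _ IH HA|α A f Hl Hf IH HA];
    intros C HC; destruct HC as [α' C Hα' HC|α' β' C' C Hs' HC' HC|α' C g Hl' Hg HC];
    try solve [destruct (succ_not_empty Hs Hα')|destruct (succ_not_empty Hs' Hα)
         |destruct Hl as (_ & Hl & He); firstorder
         |destruct Hl' as (_ & Hl & He); firstorder].
  - apply empty_unique; auto.
  - rewrite (succ_injective Hs' Hs) in HC'. rewrite <- (IH _ HC') in HC.
    apply extensionality. intros z. rewrite HA, HC. tauto.
  - apply extensionality. intros z. rewrite HA, HC.
    split; intros (β & Hb & Hz); exists β;
      rewrite (IH β Hb (g β) (Hg β Hb)) in *; auto.
Qed.

Lemma Lset_exists α : ordinal α -> exists A, Lset α A.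
Proof.
  induction α as [α IH] using (well_founded_ind mem_well_founded). intros Ha.
  destruct (ordinal_cases Ha) as [H|[[β H]|H]].
  - exists α. apply Lset_zero; auto.
  - assert (Hb : β ∈ α) by (apply H; auto).
    destruct (IH β Hb (ordinal_mem Ha Hb)) as [B HB].
    destruct (powerset B) as [p Hp].
    destruct (separation (definable_subset B) p) as [A HA].
    exists A. apply (Lset_succ H HB). intros x. rewrite HA, Hp.
    split; [tauto|]. intros Hx. split; auto. apply Hx.
  - destruct (@choose_function V (fun β => β ∈ α) Lset) as [f Hf].
    { intros β Hb. apply IH; auto. eapply ordinal_mem; eauto. }
    destruct (indexed_union f α) as [A HA]. exists A.
    exact (Lset_limit H Hf HA).
Qed.

Definition L δ : V := epsilon universe_inhabited (Lset δ).

Lemma L_spec δ : ordinal δ -> Lset δ (L δ).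
Proof. intros H. unfold L. apply epsilon_spec, Lset_exists, H. Qed.

Lemma L_eq δ A : ordinal δ -> Lset δ A -> L δ = A.
Proof. intros H HA. exact (Lset_unique (L_spec H) HA). Qed.

Lemma L_empty δ x : ordinal δ -> is_empty δ -> ~ x ∈ L δ.
Proof.
  intros Ho He. destruct (L_spec Ho) as [α A _ HA|α β B A Hs|α A f Hl].
  - apply HA.
  - destruct (succ_not_empty Hs He).
  - destruct Hl. tauto.
Qed.

Lemma L_succ δ β x :
  ordinal δ -> is_succ β δ -> (x ∈ L δ <-> definable_subset (L β) x).
Proof.
  intros Ho Hs. assert (Hb : ordinal β).
  { apply (ordinal_mem Ho), Hs. auto. }
  destruct (L_spec Ho) as [α A He|α β' B A Hs' HB HA|α A f Hl].
  - destruct (succ_not_empty Hs He).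
  - rewrite (succ_injective Hs' Hs) in HB. rewrite (L_eq Hb HB). apply HA.
  - destruct Hl as (_ & _ & Hl). destruct Hl. eauto.
Qed.

Lemma L_limit δ x :
  limit δ -> (x ∈ L δ <-> exists β, β ∈ δ /\ x ∈ L β).
Proof.
  intros Hl. assert (Ho := proj1 Hl).
  destruct (L_spec Ho) as [α A He|α β B A Hs|α A f _ Hf HA].
  - destruct Hl. tauto.
  - destruct Hl as (_ & _ & Hl). destruct Hl. eauto.
  - rewrite HA. split; intros (β & Hb & H); exists β; split; auto;
      rewrite (L_eq (ordinal_mem Ho Hb) (Hf β Hb)) in *; auto.
Qed.

Lemma L_in_R δ x : ordinal δ -> x ∈ L δ -> in_R δ x.
Proof.
  revert x. induction δ as [δ IH] using (well_founded_ind mem_well_founded).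
  intros x Ho Hx. destruct (ordinal_cases Ho) as [H|[[β H]|H]].
  - destruct (L_empty Ho H Hx).
  - apply (L_succ x Ho H) in Hx. assert (Hb : β ∈ δ) by (apply H; auto).
    apply (in_R_step Ho Hb). intros y Hy.
    apply IH; auto. { eapply ordinal_mem; eauto. } apply Hx, Hy.
  - apply (L_limit x H) in Hx as (β & Hb & Hx).
    apply (in_R_mono Ho Hb). apply IH; auto. eapply ordinal_mem; eauto.
Qed.

Lemma constructible_in_L x : constructible x -> exists δ, ordinal δ /\ x ∈ L δ.
Proof.
  intros (δ & A & Ho & HA & Hx). exists δ. rewrite (L_eq Ho HA). auto.
Qed.

Lemma type_dom_set κ k :
  ordinal κ -> exists t, forall x, x ∈ t <-> type_dom (in_R κ) k x.
Proof.
  intros Hk. induction k as [|k [t Ht]]; simpl.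
  - apply in_R_set, Hk.
  - destruct (powerset t) as [p Hp]. exists p. intros x. rewrite Hp.
    split; intros H y Hy; apply Ht; auto.
Qed.

(** The objects of each type over R(κ) form a set, so by Replacement the stages
    at which they are constructed are bounded. *)
Lemma types_constructed_below κ n :
  V_equals_L V -> ordinal κ ->
  exists α, ordinal α /\ forall k x, k < n -> type_dom (in_R κ) k x ->
    exists δ, δ ∈ α /\ ordinal δ /\ x ∈ L δ.
Proof.
  intros HL Hk. destruct (@choose_function V (fun _ => True)
    (fun x δ => ordinal δ /\ x ∈ L δ)) as [f Hf].
  { intros x _. apply constructible_in_L, HL. }
  induction n as [|n (α & Ha & IH)].
  - exists κ. split; auto. lia.
  - destruct (type_dom_set n Hk) as [t Ht].
    destruct (@ordinal_bound _ f t) as (σ & Hs & Hst).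
    { intros x _. apply (Hf x I). }
    assert (exists τ, ordinal τ /\ σ ⊆ τ /\ α ⊆ τ) as (τ & Hτ & H1 & H2).
    { destruct (ordinal_trichotomy Ha Hs) as [H|[H|H]].
      - exists σ. split; [|split]; auto. intros z. eapply ordinal_transitive; eauto.
      - exists σ. subst. auto.
      - exists α. split; [|split]; auto. intros z. eapply ordinal_transitive; eauto. }
    exists τ. split; auto. intros k x Hlt Hx.
    assert (k < n \/ k = n) as [Hkn| ->] by lia.
    + destruct (IH k x Hkn Hx) as (δ & Hd & H). exists δ. auto.
    + exists (f x). split; [|apply (Hf x I)]. apply H1, Hst, Ht, Hx.
Qed.
End Constructible.

(** * First-order definable relations *)

Section Definability.
Context {V : zfc_universe}.
Implicit Types (D X : V -> Prop) (e : nat -> V).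

Lemma upd_same e i x : upd e i x i = x.
Proof. unfold upd. rewrite Nat.eqb_refl. reflexivity. Qed.

Lemma upd_other e i j x : j <> i -> upd e i x j = e j.
Proof. intros H. unfold upd. apply Nat.eqb_neq in H. rewrite H. reflexivity. Qed.

Lemma upd_cases e i j x :
  (j = i /\ upd e i x j = x) \/ (j <> i /\ upd e i x j = e j).
Proof.
  destruct (Nat.eq_dec j i) as [->|H].
  - left. rewrite upd_same. auto.
  - right. rewrite upd_other; auto.
Qed.

Lemma sat_ext M φ e e' :
  (forall i, free i φ -> e i = e' i) -> (sat M e φ <-> sat M e' φ).
Proof.
  revert e e'.
  induction φ as [|i j|i j|i|φ IHφ ψ IHψ|i φ IH]; simpl; intros e e' H.
  - tauto.
  - rewrite !H by auto. tauto.
  - rewrite !H by auto. tauto.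
  - rewrite !H by auto. tauto.
  - rewrite (IHφ e e'), (IHψ e e') by auto. tauto.
  - split; intros Hs x Hx; specialize (Hs x Hx); revert Hs; apply IH;
      intros j Hj; destruct (upd_cases e i j x) as [[E ->]|[E ->]];
      destruct (upd_cases e' i j x) as [[E' ->]|[E' ->]]; try tauto;
      try (symmetry; apply H); auto.
Qed.

Lemma free_bounded φ : exists b, forall i, free i φ -> i < b.
Proof.
  induction φ as [|i j|i j|i|φ [b Hb] ψ [c Hc]|i φ [b Hb]]; simpl.
  - exists 0. tauto.
  - exists (1 + i + j). intros; lia.
  - exists (1 + i + j). intros; lia.
  - exists (1 + i). intros; lia.
  - exists (b + c). intros i [H|H]; [apply Hb in H|apply Hc in H]; lia.
  - exists b. intros j [_ H]. auto.
Qed.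

Lemma function_bounded (r : nat -> nat) b : exists m, forall i, i < b -> r i < m.
Proof.
  induction b as [|b [m Hm]].
  - exists 0. lia.
  - exists (1 + m + r b). intros i Hi. assert (i < b \/ i = b) as [H| ->] by lia.
    + apply Hm in H. lia.
    + lia.
Qed.

(** Renaming must avoid capture; since it is free to rename bound variables, the
    new formula is only asserted to exist. *)
Lemma sat_rename φ (r : nat -> nat) :
  exists φ', forall M e, sat M e φ' <-> sat M (fun i => e (r i)) φ.
Proof.
  revert r. induction φ as [|i j|i j|i|φ IHφ ψ IHψ|i φ IH]; intros r.
  - exists Bot. simpl. tauto.
  - exists (Eq (r i) (r j)). simpl. tauto.
  - exists (Rel (r i) (r j)). simpl. tauto.
  - exists (Pred (r i)). simpl. tauto.
  - destruct (IHφ r) as [φ' Hφ], (IHψ r) as [ψ' Hψ].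
    exists (Imp φ' ψ'). intros M e. simpl. rewrite Hφ, Hψ. tauto.
  - (* the bound variable becomes m, which no free variable is sent to *)
    destruct (free_bounded φ) as [b Hb], (function_bounded r b) as [m Hm].
    destruct (IH (fun j => if Nat.eqb j i then m else r j)) as [φ' Hφ].
    exists (All m φ'). intros M e. simpl.
    enough (E : forall x, sat M (upd e m x) φ' <->
                   sat M (upd (fun j => e (r j)) i x) φ) by firstorder.
    intros x. rewrite Hφ. apply sat_ext. intros j Hj.
    destruct (upd_cases (fun j => e (r j)) i j x) as [[E ->]|[E ->]].
    + rewrite E, Nat.eqb_refl. apply upd_same.
    + rewrite (proj2 (Nat.eqb_neq j i) E). apply upd_other.
      specialize (Hm j (Hb j Hj)). lia.
Qed.

(** The classes over which relations are to be defined: closed enough for tuples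
    of elements and numerals to exist and to be absolute. *)
Definition pair_closed D :=
  (forall x y, D x -> y ∈ x -> D y) /\
  (forall a b, D a -> D b -> exists c, D c /\ is_pair c a b) /\
  (forall n, D (num n)).

Definition is_opair z a b :=
  exists u v : V, is_pair u a a /\ is_pair v a b /\ is_pair z u v.

Definition is_quad z (t a b c : V) :=
  exists p q : V, is_opair p t a /\ is_opair q b c /\ is_opair z p q.

(** A unary predicate read as a sequence of ternary relations. *)
Definition decode X (n : nat) (a b c : V) := exists z, is_quad z (num n) a b c /\ X z.

(** A relation may refer to the class, to its unary predicate, and to an
    assignment. *)
Definition relation := (V -> Prop) -> (V -> Prop) -> (nat -> V) -> Prop.

(** One formula must work for all classes at once, so that definable relations
    pass from R(κ) to its elementary extensions. *)
Definition definable (P : relation) := exists φ, forall D X, pair_closed D ->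
  forall e, (forall i, D (e i)) ->
  (sat (Structure D mem X) e φ <-> P D X e).

Implicit Types P Q : relation.

Lemma def_equiv P Q :
  (forall D X, pair_closed D -> forall e, (forall i, D (e i)) -> (P D X e <-> Q D X e)) ->
  definable P -> definable Q.
Proof.
  intros H [φ Hφ]. exists φ. intros D X HG e He. rewrite (Hφ D X HG e He). auto.
Qed.

Lemma def_imp P Q : definable P -> definable Q ->
  definable (fun D X e => P D X e -> Q D X e).
Proof.
  intros [φ Hφ] [ψ Hψ]. exists (Imp φ ψ). intros D X HG e He. simpl.
  rewrite (Hφ D X HG e He), (Hψ D X HG e He). tauto.
Qed.

Lemma def_const (A : Prop) : definable (fun _ _ _ => A).
Proof.
  destruct (classic A) as [H|H].
  - exists (Imp Bot Bot). simpl. tauto.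
  - exists Bot. simpl. tauto.
Qed.

Lemma def_not P : definable P -> definable (fun D X e => ~ P D X e).
Proof. intros H. apply (def_imp H (def_const False)). Qed.

Lemma def_or P Q : definable P -> definable Q ->
  definable (fun D X e => P D X e \/ Q D X e).
Proof.
  intros HP HQ. apply def_equiv with (2 := def_imp (def_not HP) HQ).
  intros D X _ e _. tauto.
Qed.

Lemma def_and P Q : definable P -> definable Q ->
  definable (fun D X e => P D X e /\ Q D X e).
Proof.
  intros HP HQ. apply def_equiv with (2 := def_not (def_imp HP (def_not HQ))).
  intros D X _ e _. tauto.
Qed.

Lemma def_iff P Q : definable P -> definable Q ->
  definable (fun D X e => P D X e <-> Q D X e).
Proof. intros HP HQ. apply def_and; apply def_imp; auto. Qed.

Lemma def_mem i j : definable (fun _ _ e => e i ∈ e j).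
Proof. exists (Rel i j). simpl. tauto. Qed.

Lemma def_eq i j : definable (fun _ _ e => e i = e j).
Proof. exists (Eq i j). simpl. tauto. Qed.

Lemma def_rename P (r : nat -> nat) :
  definable P -> definable (fun D X e => P D X (fun i => e (r i))).
Proof.
  intros [φ Hφ]. destruct (sat_rename φ r) as [φ' Hφ']. exists φ'.
  intros D X HG e He. rewrite Hφ'. apply (Hφ D X HG (fun i => e (r i))). auto.
Qed.

Lemma upd_in D e i x :
  (forall j, D (e j)) -> D x -> forall j, D (upd e i x j).
Proof. intros He Hx j. destruct (upd_cases e i j x) as [[_ ->]|[_ ->]]; auto. Qed.

Lemma def_all_upd P i :
  definable P -> definable (fun D X e => forall x, D x -> P D X (upd e i x)).
Proof.
  intros [φ Hφ]. exists (All i φ). intros D X HG e He. simpl.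
  split; intros H x Hx; apply (Hφ D X HG _ (upd_in i He Hx)); auto.
Qed.

(** A quantifier whose bound variable becomes entry 0 of the assignment, the
    other entries moving up by one: in this form the definability of an
    explicit relation follows by applying these lemmas along its syntax. *)
Lemma def_all (Q : (V -> Prop) -> (V -> Prop) ->
                   (nat -> V) -> V -> Prop) :
  definable (fun D X e => Q D X (fun n => e (S n)) (e 0)) ->
  definable (fun D X e => forall x, D x -> Q D X e x).
Proof.
  intros [φ Hφ]. destruct (free_bounded φ) as [m Hm].
  destruct (sat_rename φ (fun i => match i with 0 => m | S n => n end)) as [φ' Hφ'].
  exists (All m φ'). intros D X HG e He. simpl.
  enough (E : forall x, D x ->
    (sat (Structure D mem X) (upd e m x) φ' <-> Q D X e x)) by firstorder.
  intros x Hx.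
  assert (E := Hφ D X HG (fun i => match i with 0 => x | S n => e n end)).
  simpl in E. rewrite <- E by (intros [|i]; auto).
  rewrite Hφ'. apply sat_ext. intros [|i] Hi.
  - apply upd_same.
  - apply upd_other. apply Hm in Hi. lia.
Qed.

Lemma def_ex (Q : (V -> Prop) -> (V -> Prop) ->
                  (nat -> V) -> V -> Prop) :
  definable (fun D X e => Q D X (fun n => e (S n)) (e 0)) ->
  definable (fun D X e => exists x, D x /\ Q D X e x).
Proof.
  intros H. apply def_not in H.
  apply (@def_all (fun D X e x => ~ Q D X e x)) in H. apply def_not in H.
  revert H. apply def_equiv. intros D X _ e _. split.
  - intros N. apply NNPP. intros N'. apply N. intros x Hx Hq. eauto.
  - intros (x & Hx & Hq) N. exact (N x Hx Hq).
Qed.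

Lemma def_ball (Q : (V -> Prop) -> (V -> Prop) ->
                    (nat -> V) -> V -> Prop) i :
  definable (fun D X e => Q D X (fun n => e (S n)) (e 0)) ->
  definable (fun D X e => forall x, x ∈ e i -> Q D X e x).
Proof.
  intros H.
  apply def_equiv with (P := fun D X e => forall x, D x -> x ∈ e i -> Q D X e x).
  - intros D X (Ht & _) e He. split; intros H1 x Hx; eauto.
  - apply def_all with (Q := fun D X e x => x ∈ e i -> Q D X e x).
    apply def_imp; auto. apply def_mem.
Qed.

Lemma def_bex (Q : (V -> Prop) -> (V -> Prop) ->
                   (nat -> V) -> V -> Prop) i :
  definable (fun D X e => Q D X (fun n => e (S n)) (e 0)) ->
  definable (fun D X e => exists x, x ∈ e i /\ Q D X e x).
Proof.
  intros H.
  apply def_equiv with (P := fun D X e => exists x, D x /\ x ∈ e i /\ Q D X e x).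
  - intros D X (Ht & _) e He. split; [intros (x & _ & H1)|intros (x & Hx & H1)];
      exists x; eauto.
  - apply def_ex with (Q := fun D X e x => x ∈ e i /\ Q D X e x).
    apply def_and; auto. apply def_mem.
Qed.

End Definability.

Ltac def_step :=
  first
  [ assumption
  | apply def_mem
  | apply def_eq
  | apply def_const
  | match goal with
    | |- definable (fun _ _ _ => ~ _) => apply def_not
    | |- definable (fun _ _ _ => _ /\ _) => apply def_and
    | |- definable (fun _ _ _ => _ \/ _) => apply def_or
    | |- definable (fun _ _ _ => _ <-> _) => apply def_iff
    end
  | apply def_ball
  | apply def_bex
  | apply def_all
  | apply def_ex
  | apply def_imp ]; cbv beta.
Ltac def := repeat def_step.

(** * Definability of basic notions *)

Section DefinableNotions.
Context {V : zfc_universe}.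
Implicit Types (D : V -> Prop) (e : nat -> V).

Lemma def_is_pair i j k : definable (fun _ _ e => is_pair (e i) (e j) (e k)).
Proof.
  apply def_equiv with (P := fun D X e => (forall z, z ∈ e i -> z = e j \/ z = e k)
                              /\ (e j ∈ e i /\ e k ∈ e i)).
  - intros D X _ e _. unfold is_pair. split.
    + intros (H1 & H2 & H3) z. split; auto. intros [->| ->]; auto.
    + intros H. repeat split; try (intros z); apply H; auto.
  - def.
Qed.

Lemma pair_closed_pair D c a b : pair_closed D -> D a -> D b -> is_pair c a b -> D c.
Proof.
  intros (_ & H & _) Ha Hb Hc. destruct (H a b Ha Hb) as (c' & Hc' & Hp).
  replace c with c'; auto. apply extensionality. intros z. rewrite (Hp z), (Hc z).
  tauto.
Qed.

Lemma pair_closed_opair D z a b : pair_closed D -> D a -> D b -> is_opair z a b -> D z.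
Proof.
  intros H Ha Hb (u & v & Hu & Hv & Hz).
  apply (@pair_closed_pair D z u v H);
    [apply (@pair_closed_pair D u a a H)|apply (@pair_closed_pair D v a b H)|]; auto.
Qed.

Lemma def_is_opair i j k : definable (fun _ _ e => is_opair (e i) (e j) (e k)).
Proof.
  apply def_equiv with (P := fun D X e => exists u, D u /\ exists v, D v /\
    (is_pair u (e j) (e j) /\ is_pair v (e j) (e k) /\ is_pair (e i) u v)).
  - intros D X HG e He. split.
    + intros (u & _ & v & _ & H). exists u, v. exact H.
    + intros (u & v & Hu & Hv & Hz).
      exists u. split; [eapply pair_closed_pair; eauto|].
      exists v. split; [eapply pair_closed_pair; eauto|]. auto.
  - def; apply def_is_pair.
Qed.

Lemma def_num n i : definable (fun _ _ e => e i = num n).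
Proof.
  revert i. induction n as [|n IH]; intros i; simpl.
  - apply def_equiv with (P := fun D X e => forall z, z ∈ e i -> False).
    + intros D X _ e _. split.
      * intros H. apply empty_unique; [exact H|apply empty_set_spec].
      * intros ->. apply empty_set_spec.
    + def.
  - apply def_equiv with (P := fun D X e => exists y, D y /\ y = num n /\
      (forall z, z ∈ e i -> z ∈ y \/ z = y) /\ (forall z, z ∈ y -> z ∈ e i)
      /\ y ∈ e i).
    + intros D X (_ & _ & Hn) e _. split.
      * intros (y & _ & -> & H1 & H2 & H3). apply extensionality. intros z.
        rewrite mem_succ. split; auto. intros [H| ->]; auto.
      * intros ->. exists (num n). split; [apply Hn|]. split; auto.
        repeat split; try intros z; rewrite mem_succ; auto.
    + def. apply IH.
Qed.

(** Each numeral is definable without parameters, hence may occur as a constant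
    in a definition. *)
Lemma def_at_num (Q : (V -> Prop) -> (V -> Prop) ->
                      (nat -> V) -> V -> Prop) n :
  definable (fun D X e => Q D X (fun n => e (S n)) (e 0)) ->
  definable (fun D X e => Q D X e (num n)).
Proof.
  intros H.
  apply def_equiv with (P := fun D X e => exists y, D y /\ y = num n /\ Q D X e y).
  - intros D X (_ & _ & Hn) e _. split.
    + intros (y & _ & -> & H1). exact H1.
    + intros H1. exists (num n). auto.
  - def. apply def_num.
Qed.

Lemma def_pred i : definable (fun _ X e => X (e i)).
Proof. exists (Pred i). simpl. tauto. Qed.

Lemma def_decode n i j k : definable (fun _ X e => decode X n (e i) (e j) (e k)).
Proof.
  apply def_at_num with (Q := fun D X e t =>
    exists z, is_quad z t (e i) (e j) (e k) /\ X z).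
  apply def_equiv with (P := fun D X e =>
    exists p, D p /\ exists q, D q /\ exists z, D z /\
    (is_opair p (e 0) (e (S i)) /\ is_opair q (e (S j)) (e (S k)) /\
     is_opair z p q /\ X z)).
  - intros D X HG e He. simpl. split.
    + intros (p & _ & q & _ & z & _ & Hp & Hq & Hz & Hs).
      exists z. split; auto. exists p, q. auto.
    + intros (z & (p & q & Hp & Hq & Hz) & Hs).
      assert (D p) by (eapply (pair_closed_opair HG); [| |eassumption]; auto).
      assert (D q) by (eapply (pair_closed_opair HG); [| |eassumption]; auto).
      assert (D z) by (eapply (pair_closed_opair HG); [| |eassumption]; auto).
      exists p. split; auto. exists q. split; auto. exists z. auto.
  - def; try apply def_is_opair. apply def_pred.
Qed.

End DefinableNotions.

(** * Definability of first-order satisfaction *)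

Section DefinableSatisfaction.
Context {V : zfc_universe}.
Implicit Types (D X : V -> Prop) (e : nat -> V) (P : @relation V).

Lemma def_transitive i : definable (fun _ _ e => transitive (e i)).
Proof. unfold transitive. def. Qed.

Lemma def_ordinal i : definable (fun _ _ e => ordinal (e i)).
Proof. unfold ordinal. def; apply def_transitive. Qed.

Lemma def_is_empty i : definable (fun _ _ e => is_empty (e i)).
Proof.
  apply def_equiv with (P := fun D X e => forall z, z ∈ e i -> False).
  - intros. unfold is_empty. tauto.
  - def.
Qed.

Lemma def_is_succ i j : definable (fun _ _ e => is_succ (e i) (e j)).
Proof.
  apply def_equiv with (P := fun D X e => (forall z, z ∈ e j -> z ∈ e i \/ z = e i)
                              /\ (forall z, z ∈ e i -> z ∈ e j) /\ e i ∈ e j).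
  - intros D X _ e _. unfold is_succ. split.
    + intros (H1 & H2 & H3) z. split; auto. intros [H| ->]; auto.
    + intros H. repeat split; try intros z; rewrite ?H; auto.
  - def.
Qed.

Lemma def_limit i : definable (fun _ _ e => limit (e i)).
Proof.
  apply def_equiv with (P := fun D X e => ordinal (e i) /\ ~ is_empty (e i) /\
    ~ exists β, β ∈ e i /\ is_succ β (e i)).
  - intros D X _ e _. unfold limit.
    enough ((exists β, β ∈ e i /\ is_succ β (e i)) <-> exists β, is_succ β (e i))
      by tauto.
    split; [firstorder|]. intros [β H]. exists β. split; auto. apply H. auto.
  - def; auto using def_ordinal, def_is_empty, def_is_succ.
Qed.

(** Entry 0 of the assignment is the domain, and variable i of φ is entry i + 1. *)
Lemma def_sat φ :
  definable (fun _ _ e => sat (mem_structure (e 0)) (fun i => e (S i)) φ).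
Proof.
  induction φ as [|i j|i j|i|φ IHφ ψ IHψ|i φ IH]; simpl; try solve [def].
  apply def_equiv with (P := fun D X e => forall x, D x ->
    upd e (S i) x (S i) ∈ upd e (S i) x 0 ->
    sat (mem_structure (upd e (S i) x 0)) (fun j => upd e (S i) x (S j)) φ).
  - intros D X (Ht & _) e He. split.
    + intros H x Hx. apply (H x (Ht _ _ (He 0) Hx)). rewrite upd_same. exact Hx.
    + intros H x _ Hx. rewrite upd_same in Hx. exact (H x Hx).
  - apply def_all_upd with (P := fun D X e => e (S i) ∈ e 0 ->
      sat (mem_structure (e 0)) (fun j => e (S j)) φ).
    apply def_imp; auto. apply def_mem.
Qed.

(** An assignment is not an element that a formula can quantify over; but P
    depends on finitely many entries, so finitely many quantifiers suffice. *)
Lemma def_ex_tail P c : definable P ->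
  definable (fun D X e => exists e', (forall i, D (e' i)) /\
    (forall i, i < c -> e' i = e i) /\ P D X e').
Proof.
  intros [φ Hφ]. destruct (free_bounded φ) as [b Hb].
  assert (Hk : forall k, exists ψ, forall M e, (forall i, carrier M (e i)) ->
    (sat M e ψ <-> exists e', (forall i, carrier M (e' i)) /\
      (forall i, i < c \/ c + k <= i -> e' i = e i) /\ sat M e' φ)).
  { induction k as [|k [ψ IH]].
    - exists φ. intros M e He. split.
      + intros H. exists e. auto.
      + intros (e' & He' & E & H).
        replace e with e'; auto. extensionality i. apply E. lia.
    - exists (Imp (All (c + k) (Imp ψ Bot)) Bot). intros M e He. simpl. split.
      + intros H. apply NNPP. intros N. apply H. intros x Hx Hs.
        apply IH in Hs.
        * destruct Hs as (e' & He' & E & Hs). apply N. exists e'.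
          split; [|split]; auto. intros i Hi. rewrite E by lia.
          apply upd_other. lia.
        * intros i. destruct (upd_cases e (c + k) i x) as [[_ ->]|[_ ->]]; auto.
      + intros (e' & He' & E & Hs) N. apply (N (e' (c + k))); auto.
        apply IH.
        * intros i.
          destruct (upd_cases e (c + k) i (e' (c + k))) as [[_ ->]|[_ ->]]; auto.
        * exists e'. split; [|split]; auto. intros i Hi.
          destruct (upd_cases e (c + k) i (e' (c + k))) as [[-> ->]|[Hn ->]]; auto.
          apply E. lia. }
  destruct (Hk b) as [ψ Hψ]. exists ψ. intros D X HG e He. rewrite Hψ by auto.
  split.
  - intros (e' & He' & E & H). exists e'. split; [|split]; auto.
    apply (Hφ D X HG); auto.
  - intros (e' & He' & E & H).
    exists (fun i => if Nat.ltb i (c + b) then e' i else e i).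
    split; [|split].
    + intros i. simpl. destruct (Nat.ltb i (c + b)); auto.
    + intros i Hi. destruct (Nat.ltb_spec i (c + b)); auto.
      apply E. lia.
    + apply (Hφ D X HG) in H; auto. revert H. apply sat_ext.
      intros i Hi. apply Hb in Hi. destruct (Nat.ltb_spec i (c + b)); auto. lia.
Qed.

(** The part of [definable_subset] that concerns a single formula. *)
Definition defined_by φ (A x : V) := x ⊆ A /\
  exists e : nat -> V, (forall i, free i φ -> i <> 0 -> e i ∈ A) /\
    forall y, y ∈ A -> (y ∈ x <-> sat (mem_structure A) (upd e 0 y) φ).

Lemma def_for_nat (R : nat -> Prop) (P : nat -> @relation V) b :
  (forall i, R i -> i < b) -> (forall i, definable (P i)) ->
  definable (fun D X e => forall i, R i -> P i D X e).
Proof.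
  intros Hb HP.
  apply def_equiv with (P := fun D X e => forall i, i < b -> R i -> P i D X e).
  { intros D X _ e _. firstorder. }
  clear Hb. induction b as [|b IH].
  - apply def_equiv with (2 := def_const True). intros D X _ e _.
    split; auto. intros _ i Hi. lia.
  - apply def_equiv with (2 := def_and IH (def_imp (def_const (R b)) (HP b))).
    intros D X _ e _. split.
    + intros [H1 H2] i Hi. assert (i < b \/ i = b) as [Hl| ->] by lia; auto.
    + intros H. split; auto.
Qed.

(** Here entry 0 is the domain A, entry 1 the subset of A being defined, and
    variable i of φ is entry i + 2. *)
Lemma def_comprehension φ : definable (fun _ _ e => forall y, y ∈ e 0 ->
  (y ∈ e 1 <-> sat (mem_structure (e 0)) (upd (fun i => e (S (S i))) 0 y) φ)).
Proof.
  def.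
  assert (H := def_rename (fun i => match i with 0 => 1 | 1 => 0 | S (S i) => i + 4 end)
                 (def_sat φ)).
  revert H. apply def_equiv. intros D X _ e _. simpl. apply sat_ext.
  intros [|i] _; unfold upd; simpl; auto. f_equal. lia.
Qed.

Lemma def_defined_by φ i j : definable (fun _ _ e => defined_by φ (e i) (e j)).
Proof.
  enough (H : definable (fun _ _ e => defined_by φ (e 0) (e 1))).
  { apply (def_rename (fun k => match k with 0 => i | _ => j end)) in H. exact H. }
  destruct (free_bounded φ) as [b Hb].
  apply def_equiv with (P := fun D X e => (forall z, z ∈ e 1 -> z ∈ e 0) /\
    exists e', (forall i, D (e' i)) /\ (forall i, i < 2 -> e' i = e i) /\
     ((forall i, (free i φ /\ i <> 0) -> e' (S (S i)) ∈ e' 0) /\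
      forall y, y ∈ e' 0 -> (y ∈ e' 1 <->
        sat (mem_structure (e' 0)) (upd (fun i => e' (S (S i))) 0 y) φ))).
  - intros D X (Ht & _) e He. unfold defined_by.
    apply and_iff_compat_l. split.
    + intros (e' & He' & E & H1 & H2).
      rewrite (E 0) in H1, H2 by lia. rewrite (E 1) in H2 by lia.
      exists (fun i => e' (S (S i))). split; [auto|exact H2].
    + intros (f & H1 & H2).
      set (f' := fun i => if excluded_middle_informative (free i φ /\ i <> 0)
                          then f i else e 0).
      exists (fun k => match k with 0 => e 0 | 1 => e 1 | S (S k) => f' k end).
      assert (Hf : forall k, f' k ∈ e 0 \/ f' k = e 0).
      { intros k. unfold f'. destruct (excluded_middle_informative _); intuition. }
      split; [|split; [|split]].
      * intros [|[|k]]; auto. destruct (Hf k) as [Hk| ->]; eauto.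
      * intros [|[|k]]; auto. lia.
      * intros k [Hk Hk']. unfold f'. destruct (excluded_middle_informative _); intuition.
      * intros y Hy. rewrite (H2 y Hy). apply sat_ext. intros [|k] Hk; auto.
        change (f (S k) = f' (S k)). unfold f'.
        destruct (excluded_middle_informative (free (S k) φ /\ S k <> 0)) as [|n];
          auto.
        destruct n. auto.
  - def. apply def_ex_tail with (P := fun D X e' =>
     ((forall i, (free i φ /\ i <> 0) -> e' (S (S i)) ∈ e' 0) /\
      forall y, y ∈ e' 0 -> (y ∈ e' 1 <->
        sat (mem_structure (e' 0)) (upd (fun i => e' (S (S i))) 0 y) φ))).
    apply def_and; [|apply def_comprehension].
    apply def_for_nat with (b := b) (P := fun i D X e' => e' (S (S i)) ∈ e' 0).
    + intros k [Hk _]. auto.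
    + intros k. apply def_mem.
Qed.

(** Separation inside entry 0; entries from 2 on are the parameters, as variable
    0 of φ ranges over the elements to be separated. *)
Lemma def_separation φ : definable (fun D _ e => exists x, D x /\
  (forall z, z ∈ x -> z ∈ e 0) /\ forall y, y ∈ e 0 ->
  (y ∈ x <-> sat (mem_structure (e 0)) (upd (fun i => e (S i)) 0 y) φ)).
Proof.
  def_step. def_step; [def|].
  exact (def_rename (fun i => match i with 0 => 1 | 1 => 0 | S i => S i end)
    (def_comprehension φ)).
Qed.

(** With the number j fixed from outside, the unbounded disjunction over all
    formulas has at most one disjunct. *)
Lemma def_coded (I : Type) (code : I -> nat) (P : I -> @relation V) j :
  (forall a b, code a = code b -> a = b) -> (forall a, definable (P a)) ->
  definable (fun D X e => exists a, code a = j /\ P a D X e).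
Proof.
  intros Hc HP. destruct (classic (exists a, code a = j)) as [[a Ha]|N].
  - apply def_equiv with (2 := HP a). intros D X _ e _. split.
    + intros H. eauto.
    + intros (b & Hb & H). rewrite <- Ha in Hb. apply Hc in Hb. subst. exact H.
  - apply def_equiv with (2 := def_const False). intros D X _ e _.
    split; [tauto|]. intros (a & Ha & _). eauto.
Qed.

End DefinableSatisfaction.

(** * Definability of higher-order satisfaction *)

Section DefinableHigherOrder.
Context {V : zfc_universe}.
Implicit Types (D X U : V -> Prop) (e : nat -> V) (h : nat -> nat -> V).

Lemma hupd_cases h k i x l j :
  ((l = k /\ j = i) /\ hupd h k i x l j = x) \/
  (~ (l = k /\ j = i) /\ hupd h k i x l j = h l j).
Proof.
  unfold hupd. destruct (Nat.eqb_spec l k), (Nat.eqb_spec j i); simpl; tauto.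
Qed.

Lemma hsat_ext D U φ h h' :
  (forall k i, hfree k i φ -> h k i = h' k i) -> (hsat D U h φ <-> hsat D U h' φ).
Proof.
  revert h h'.
  induction φ as [|k i j|i j|k i j|i|φ IHφ ψ IHψ|k i φ IH]; simpl; intros h h' H;
    try solve [tauto | rewrite !H by auto; tauto].
  - rewrite (IHφ h h'), (IHψ h h') by auto. tauto.
  - split; intros Hs x Hx; specialize (Hs x Hx); revert Hs; apply IH;
      intros l j Hj; destruct (hupd_cases h k i x l j) as [[E ->]|[E ->]];
      destruct (hupd_cases h' k i x l j) as [[E' ->]|[E' ->]]; try tauto;
      try (symmetry; apply H); auto.
Qed.

Lemma sentence_models D U φ h :
  sentence φ -> hsat D U h φ -> models D U φ.
Proof.
  intros Hs H h'. revert H. apply hsat_ext. intros k i Hf. destruct (Hs k i Hf).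
Qed.

(** Satisfaction of higher-order formulas in (A, ∈, U) as seen from the class
    D, which need not contain all the objects of higher type over A. *)
Fixpoint hsat_in D (A U : V -> Prop) h φ : Prop :=
  match φ with
  | HBot => False
  | HEq k i j => h k i = h k j
  | HMem i j => h 0 i ∈ h 0 j
  | HIn k i j => h k i ∈ h (S k) j
  | HPred i => U (h 0 i)
  | HImp φ ψ => hsat_in D A U h φ -> hsat_in D A U h ψ
  | HAll k i φ =>
      forall x, D x -> type_dom A k x -> hsat_in D A U (hupd h k i x) φ
  end.

Lemma type_dom_iff (A A' : V -> Prop) k x :
  (forall y, A y <-> A' y) -> (type_dom A k x <-> type_dom A' k x).
Proof.
  intros H. revert x. induction k as [|k IH]; simpl; intros x; auto.
  split; intros Hx y Hy; apply IH; auto.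
Qed.

(** Only quantified types matter, and those of a matrix of order n lie below n. *)
Lemma hsat_in_iff D (A U A' U' : V -> Prop) n φ h :
  (forall y, A y <-> A' y) -> (forall y, U y <-> U' y) ->
  (forall k x, k < n -> type_dom A' k x -> D x) -> matrix n φ ->
  (hsat_in D A U h φ <-> hsat A' U' h φ).
Proof.
  intros HA HU HD. revert h.
  induction φ as [|k i j|i j|k i j|i|φ IHφ ψ IHψ|k i φ IH]; simpl; intros h Hn;
    try tauto.
  - apply HU.
  - rewrite IHφ, IHψ by tauto. tauto.
  - destruct Hn as [Hk Hn]. split.
    + intros H x Hx. apply IH; auto. apply H; eauto.
      rewrite (type_dom_iff _ _ HA). exact Hx.
    + intros H x _ Hx. apply IH; auto. apply H.
      rewrite <- (type_dom_iff _ _ HA). exact Hx.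
Qed.

(** Relation 0 is meant to hold of (α, α, x) when x ∈ R(α). *)
Definition coded_R D X (a x : V) := D x /\ decode X 0 a a x.

Lemma def_type_dom k i j : definable (fun D X e => type_dom (coded_R D X (e i)) k (e j)).
Proof.
  revert i j. induction k as [|k IH]; intros i j; simpl.
  - apply def_equiv with (2 := def_decode 0 i i j). intros D X _ e He.
    unfold coded_R. split; auto. tauto.
  - def. apply IH.
Qed.

(** Relation 3 is meant to hold of (b, b, x) when x belongs to the set U attached
    to b; the restriction to R(a) lets sentences be evaluated in (R(a), ∈, U ∩ R(a))
    for several a with the same U. *)
Definition coded_U D X (a b x : V) := coded_R D X a x /\ decode X 3 b b x.

(** A typed assignment read off an untyped one; entries 0 and 1 are kept for the
    domain and for the index of the set U. *)
Definition typed (e : nat -> V) k i := e (S (S (Cantor.to_nat (k, i)))).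

Lemma typed_upd e k i x :
  typed (upd e (S (S (Cantor.to_nat (k, i)))) x) = hupd (typed e) k i x.
Proof.
  extensionality l. extensionality j. unfold typed.
  destruct (hupd_cases (typed e) k i x l j) as [[[-> ->] E]|[N E]];
    unfold typed in E; rewrite E.
  - apply upd_same.
  - apply upd_other. intros H. apply N.
    assert (Hp : Cantor.to_nat (l, j) = Cantor.to_nat (k, i)) by congruence.
    apply Cantor.to_nat_inj in Hp. inversion Hp. auto.
Qed.

Lemma def_hsat φ : definable (fun D X e =>
  hsat_in D (coded_R D X (e 0)) (coded_U D X (e 0) (e 1)) (typed e) φ).
Proof.
  induction φ as [|k i j|i j|k i j|i|φ IHφ ψ IHψ|k i φ IH]; simpl;
    try solve [def | apply def_mem | apply def_eq].
  - unfold coded_U.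
    apply def_and; [|apply def_decode].
    apply (@def_type_dom 0 0 (S (S (Cantor.to_nat (0, i))))).
  - set (p := S (S (Cantor.to_nat (k, i)))).
    apply def_equiv with (P := fun D X e => forall x, D x ->
      type_dom (coded_R D X (upd e p x 0)) k (upd e p x p) ->
      hsat_in D (coded_R D X (upd e p x 0)) (coded_U D X (upd e p x 0) (upd e p x 1))
        (typed (upd e p x)) φ).
    + intros D X _ e _.
      enough (E : forall x, (type_dom (coded_R D X (upd e p x 0)) k (upd e p x p) ->
        hsat_in D (coded_R D X (upd e p x 0)) (coded_U D X (upd e p x 0) (upd e p x 1))
        (typed (upd e p x)) φ) <-> (type_dom (coded_R D X (e 0)) k x ->
        hsat_in D (coded_R D X (e 0)) (coded_U D X (e 0) (e 1))
          (hupd (typed e) k i x) φ))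
        by (split; intros H x Hx; apply E; auto).
      intros x. rewrite upd_same. change (upd e p x 0) with (e 0).
      change (upd e p x 1) with (e 1).
      replace (typed (upd e p x)) with (hupd (typed e) k i x)
        by (symmetry; apply typed_upd).
      tauto.
    + apply def_all_upd with (P := fun D X e => type_dom (coded_R D X (e 0)) k (e p) ->
        hsat_in D (coded_R D X (e 0)) (coded_U D X (e 0) (e 1)) (typed e) φ).
      apply def_imp; auto. apply def_type_dom.
Qed.

Definition npair i j := Cantor.to_nat (i, j).

Lemma npair_injective i j k l : npair i j = npair k l -> i = k /\ j = l.
Proof.
  intros H. apply (Cantor.to_nat_inj (i, j) (k, l)) in H.
  inversion H. auto.
Qed.

(** The numbers that stand for formulas in coded relations; any injection into
    the natural numbers would serve. *)
Fixpoint code (φ : formula) : nat :=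
  match φ with
  | Bot => npair 0 0
  | Eq i j => npair 1 (npair i j)
  | Rel i j => npair 2 (npair i j)
  | Pred i => npair 3 i
  | Imp φ ψ => npair 4 (npair (code φ) (code ψ))
  | All i φ => npair 5 (npair i (code φ))
  end.

Fixpoint hcode (φ : hformula) : nat :=
  match φ with
  | HBot => npair 0 0
  | HEq k i j => npair 1 (npair k (npair i j))
  | HMem i j => npair 2 (npair i j)
  | HIn k i j => npair 3 (npair k (npair i j))
  | HPred i => npair 4 i
  | HImp φ ψ => npair 5 (npair (hcode φ) (hcode ψ))
  | HAll k i φ => npair 6 (npair k (npair i (hcode φ)))
  end.

Ltac unpair := repeat match goal with
  | H : npair _ _ = npair _ _ |- _ => apply npair_injective in H as [? ?]
  end.

Lemma code_injective φ ψ : code φ = code ψ -> φ = ψ.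
Proof.
  revert ψ. induction φ; intros [] H; cbn [code] in H; unpair;
    try discriminate; try reflexivity; f_equal; auto.
Qed.

Lemma hcode_injective φ ψ : hcode φ = hcode ψ -> φ = ψ.
Proof.
  revert ψ. induction φ; intros [] H; cbn [hcode] in H; unpair;
    try discriminate; try reflexivity; f_equal; auto.
Qed.
End DefinableHigherOrder.

(** * Transitive elementary extensions *)

Section Collapse.
Context {V : zfc_universe}.
Variable (M : @structure V) (m : V).
Hypothesis set_M : forall x, carrier M x <-> x ∈ m.
Hypothesis wf_M : well_founded_structure M.

(** The image of x under the Mostowski collapse of M. *)
Inductive collapses_to : V -> V -> Prop :=
| collapses_intro x y (f : V -> V) :
    (forall z, carrier M z -> rel M z x -> collapses_to z (f z)) ->
    (forall w, w ∈ y <-> exists z, (carrier M z /\ rel M z x) /\ w = f z) ->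
    collapses_to x y.

Lemma collapses_unique x y y' : collapses_to x y -> collapses_to x y' -> y = y'.
Proof.
  intros H. revert y'. induction H as [x y f _ IH Hy].
  intros y' Hb. destruct Hb as [x y' g Hg Hy'].
  apply extensionality. intros w. rewrite Hy, Hy'.
  split; intros (z & [Hz Hr] & ->); exists z; split; auto.
  symmetry. auto.
Qed.

Lemma collapses_exists x : carrier M x -> exists y, collapses_to x y.
Proof.
  induction x as [x IH] using (well_founded_ind wf_M). intros Hx.
  destruct (@choose_function V (fun z => carrier M z /\ rel M z x) collapses_to)
    as [f Hf].
  { intros z [Hz Hr]. auto. }
  destruct (separation (fun z => rel M z x) m) as [u Hu].
  destruct (function_image f u) as [y Hy]. exists y.
  apply (@collapses_intro x y f); auto.
  intros w. rewrite Hy. split; intros (z & Hz & Hw); exists z;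
    rewrite Hu, <- set_M in *; auto.
Qed.

Definition collapse x := epsilon universe_inhabited (collapses_to x).

Lemma mem_collapse x w : carrier M x ->
  (w ∈ collapse x <-> exists z, (carrier M z /\ rel M z x) /\ w = collapse z).
Proof.
  intros Hx.
  assert (H : collapses_to x (collapse x)).
  { unfold collapse. apply epsilon_spec, collapses_exists, Hx. }
  destruct H as [x y f Hf Hy]. rewrite Hy.
  assert (E : forall z, carrier M z -> rel M z x -> f z = collapse z).
  { intros z Hz Hr. apply (collapses_unique (Hf z Hz Hr)).
    unfold collapse. apply epsilon_spec, collapses_exists, Hz. }
  split; intros (z & [Hz Hr] & ->); exists z; split; auto. symmetry; auto.
Qed.

Hypothesis extensional_M : forall x y, carrier M x -> carrier M y ->
  (forall z, carrier M z -> (rel M z x <-> rel M z y)) -> x = y.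

Lemma collapse_injective x y :
  carrier M x -> carrier M y -> collapse x = collapse y -> x = y.
Proof.
  revert y. induction x as [x IH] using (well_founded_ind wf_M).
  intros y Hx Hy E. apply extensional_M; auto. intros z Hz.
  split; intros Hr.
  - assert (H : collapse z ∈ collapse y).
    { rewrite <- E. apply mem_collapse; eauto. }
    apply mem_collapse in H as (z' & [Hz' Hr'] & E'); auto.
    rewrite (IH z) with (y := z'); auto.
  - assert (H : collapse z ∈ collapse x).
    { rewrite E. apply mem_collapse; eauto. }
    apply mem_collapse in H as (z' & [Hz' Hr'] & E'); auto.
    rewrite <- (IH z') with (y := z); auto.
Qed.

Lemma rel_collapse x y :
  carrier M x -> carrier M y -> (rel M x y <-> collapse x ∈ collapse y).
Proof.
  intros Hx Hy. rewrite mem_collapse by auto. split.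
  - intros H. exists x. auto.
  - intros (z & [Hz Hr] & E). apply collapse_injective in E; auto. subst. auto.
Qed.

Definition collapsed : structure :=
  Structure (fun y => exists x, carrier M x /\ y = collapse x) mem
    (fun y => exists x, carrier M x /\ y = collapse x /\ pred M x).

Lemma sat_collapsed φ e : (forall i, carrier M (e i)) ->
  (sat M e φ <-> sat collapsed (fun i => collapse (e i)) φ).
Proof.
  revert e. induction φ as [|i j|i j|i|φ IHφ ψ IHψ|i φ IH]; simpl; intros e He.
  - tauto.
  - split; [congruence|]. apply collapse_injective; auto.
  - apply rel_collapse; auto.
  - split; eauto. intros (x & Hx & E & Hp). apply collapse_injective in E; auto.
    subst. exact Hp.
  - rewrite IHφ, IHψ by auto. tauto.
  - assert (E : forall x, (fun j => collapse (upd e i x j)) =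
              upd (fun j => collapse (e j)) i (collapse x)).
    { intros x. extensionality j. unfold upd. destruct (Nat.eqb j i); auto. }
    split.
    + intros H y (x & Hx & ->). rewrite <- E.
      apply IH; [apply upd_in|]; auto.
    + intros H x Hx. apply IH; [apply upd_in; auto|]. rewrite E. eauto.
Qed.

(** On a transitive class that M end-extends, the collapse is the identity. *)
Lemma collapse_fixes (A : V -> Prop) :
  (forall x y, A x -> y ∈ x -> A y) -> (forall x, A x -> carrier M x) ->
  (forall a, A a -> forall b, (A b /\ b ∈ a) <-> (carrier M b /\ rel M b a)) ->
  forall a, A a -> collapse a = a.
Proof.
  intros Ht Hc He a. induction a as [a IH] using (well_founded_ind mem_well_founded).
  intros Ha. apply extensionality. intros w. rewrite mem_collapse by auto. split.
  - intros (z & H & ->). apply He in H as [H1 H2]; auto. rewrite IH; auto.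
  - intros Hw. exists w. rewrite <- He by auto. rewrite IH by eauto. eauto.
Qed.

(** The given isomorphism h from γ to the ordinals of M is inverse to the
    collapse: by induction on ξ, h(ξ) collapses to ξ. *)
Lemma height_collapsed γ ξ : height M γ -> ξ ∈ γ -> carrier collapsed ξ.
Proof.
  intros (Hg & h & Hh & Hs & Hi) Hx. exists (h ξ). split; [apply Hh, Hx|].
  revert Hx. induction ξ as [ξ IH] using (well_founded_ind mem_well_founded).
  intros Hx. assert (HO := Hh ξ Hx). destruct HO as (Hc & HT & HE).
  apply extensionality. intros w. rewrite mem_collapse by auto. split.
  - intros Hw. assert (Hwg : w ∈ γ) by (eapply ordinal_transitive; eauto).
    exists (h w). split; auto. split; [apply Hh; auto|]. apply Hi; auto.
  - intros (z & [Hz Hr] & ->).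
    assert (HO : ordinal_in M z).
    { split; [|split]; auto. intros y Hy Hyz. apply HE; auto.
      apply (HT z y); auto. }
    destruct (Hs z HO) as (η & Heta & <-). apply Hi in Hr; auto.
    rewrite <- IH; auto.
Qed.
End Collapse.

Section Extensions.
Context {V : zfc_universe}.
Implicit Types (D X : V -> Prop) (e : nat -> V) (κ α S : V).

Lemma unfoldable_limit κ : unfoldable κ -> limit κ.
Proof. intros [(_ & _ & H & _) _]. apply H. Qed.

Lemma unfoldable_omega κ : unfoldable κ -> exists w, is_omega w /\ in_R κ w.
Proof.
  intros [(_ & (w & Hw & Hwk) & _) _]. exists w. split; auto.
  apply in_R_ordinal; auto. apply Hw.
Qed.

(** Unfoldability with the end extension replaced by its collapse. *)
Lemma transitive_extension κ S α :
  unfoldable κ -> ordinal α -> (forall x, x ∈ S -> in_R κ x) ->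
  exists D X, (forall x y, D x -> y ∈ x -> D y) /\
    (forall x, in_R κ x -> D x) /\ (forall β, β ∈ α -> D β) /\
    forall φ e, (forall i, in_R κ (e i)) ->
      (sat (R_structure κ S) e φ <-> sat (Structure D mem X) e φ).
Proof.
  intros Hu Ha HS. assert (Hk : ordinal κ) by apply (unfoldable_limit Hu).
  assert (Hu' := Hu). destruct Hu as [_ Hu].
  destruct (Hu α S Ha HS) as (M & [m Hm] & Hwf & ((Hsub & Hel) & _ & Hend) &
    γ & Hg & Hag).
  assert (Hext : forall x y, carrier M x -> carrier M y ->
    (forall z, carrier M z -> (rel M z x <-> rel M z y)) -> x = y).
  { (* R(κ) is transitive, hence extensional, and M inherits this *)
    set (incl i j := All 2 (Imp (Rel 2 i) (Rel 2 j))).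
    set (ext := All 0 (All 1 (Imp (incl 0 1) (Imp (incl 1 0) (Eq 0 1))))).
    assert (H : sat M (fun _ => empty_set) ext).
    { apply Hel.
      - intros _. apply (in_R_ordinal κ (num_ordinal 0)).
        apply (num_in_limit 0), unfoldable_limit, Hu'.
      - simpl. intros x Hx y Hy H1 H2. apply extensionality. intros z.
        split; intros Hz; [apply (H1 z)|apply (H2 z)]; try exact Hz;
          [exact (in_R_transitive Hk Hx Hz)|exact (in_R_transitive Hk Hy Hz)]. }
    simpl in H. intros x y Hx Hy Hz. apply (H x Hx y Hy); intros z Hc; apply Hz, Hc. }
  exists (carrier (collapsed M)), (pred (collapsed M)). split; [|split; [|split]].
  - intros x y (u & Huc & ->) Hy. apply (mem_collapse Hm Hwf) in Hy; auto.
    destruct Hy as (z & [Hz _] & ->). exists z. auto.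
  - intros x Hx. exists x. split; [apply Hsub, Hx|]. symmetry.
    apply (collapse_fixes Hm Hwf (A := in_R κ)); auto.
    intros y z Hy Hz. eapply in_R_transitive; eauto.
  - intros β Hb. apply (height_collapsed Hm Hwf Hg).
    destruct Hag as [H| <-]; auto. destruct Hg as [Hg _].
    eapply ordinal_transitive; eauto.
  - intros φ e He. rewrite (Hel φ e He).
    rewrite (sat_collapsed Hm Hwf Hext) by (intros; apply Hsub, He).
    assert (E : (fun i => collapse M (e i)) = e).
    { extensionality i. apply (collapse_fixes Hm Hwf (A := in_R κ)); auto.
      intros y z Hy Hz. eapply in_R_transitive; eauto. }
    rewrite E. reflexivity.
Qed.
End Extensions.

(** * Extensions that contain the higher types *)

Section Coding.
Context {V : zfc_universe}.
Implicit Types (D X : V -> Prop) (e : nat -> V) (a b c κ α S : V).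

Lemma opair_injective z a b a' b' :
  is_opair z a b -> is_opair z a' b' -> a = a' /\ b = b'.
Proof.
  intros (u & v & Hu & Hv & Hz) (u' & v' & Hu' & Hv' & Hz').
  assert (Huz : u = u' \/ u = v') by (apply Hz', Hz; auto).
  assert (Hvz : v = u' \/ v = v') by (apply Hz', Hz; auto).
  assert (Huz' : u' = u \/ u' = v) by (apply Hz, Hz'; auto).
  assert (Hvz' : v' = u \/ v' = v) by (apply Hz, Hz'; auto).
  assert (E : a = a').
  { destruct Huz as [->| ->].
    - assert (H : a ∈ u') by (apply Hu; auto). apply Hu' in H. tauto.
    - assert (H : a' ∈ v') by (apply Hv'; auto). apply Hu in H.
      destruct H; congruence. }
  subst a'. split; auto.
  assert (E : u = u').
  { apply extensionality. intros t. rewrite (Hu t), (Hu' t). tauto. }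
  subst u'.
  assert (Hb : b ∈ v) by (apply Hv; auto).
  assert (Hb' : b' ∈ v') by (apply Hv'; auto).
  destruct Hvz as [->| ->].
  - apply Hu in Hb. assert (b = a) as -> by tauto.
    destruct Hvz' as [->| ->]; apply Hu in Hb'; destruct Hb'; congruence.
  - apply Hv' in Hb as [->| ->]; auto.
    apply Hv in Hb' as [->| ->]; auto.
Qed.

Lemma opair_exists D a b : pair_closed D -> D a -> D b -> exists z, D z /\ is_opair z a b.
Proof.
  intros (_ & H & _) Ha Hb.
  destruct (H a a Ha Ha) as (u & Hu & Hu'), (H a b Ha Hb) as (v & Hv & Hv').
  destruct (H u v Hu Hv) as (z & Hz & Hz'). exists z. split; auto. exists u, v. auto.
Qed.

Lemma quad_exists D t a b c : pair_closed D -> D t -> D a -> D b -> D c ->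
  exists z, D z /\ is_quad z t a b c.
Proof.
  intros H Ht Ha Hb Hc.
  destruct (opair_exists H Ht Ha) as (p & Hp & Hp').
  destruct (opair_exists H Hb Hc) as (q & Hq & Hq').
  destruct (opair_exists H Hp Hq) as (z & Hz & Hz').
  exists z. split; auto. exists p, q. auto.
Qed.

Lemma quad_injective z t a b c t' a' b' c' :
  is_quad z t a b c -> is_quad z t' a' b' c' ->
  t = t' /\ a = a' /\ b = b' /\ c = c'.
Proof.
  intros (p & q & Hp & Hq & Hz) (p' & q' & Hp' & Hq' & Hz').
  destruct (opair_injective Hz Hz') as [<- <-].
  destruct (opair_injective Hp Hp') as [<- <-].
  destruct (opair_injective Hq Hq') as [<- <-]. auto.
Qed.

Lemma num_in_R κ n : limit κ -> in_R κ (num n).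
Proof. intros H. apply in_R_ordinal; [apply num_ordinal|apply num_in_limit, H]. Qed.

Lemma pair_closed_in_R κ : limit κ -> pair_closed (in_R κ).
Proof.
  intros H. split; [|split].
  - intros x y. apply in_R_transitive, H.
  - intros a b Ha Hb. destruct (pairing a b) as [c Hc]. exists c. split; auto.
    exact (in_R_pair H Ha Hb Hc).
  - intros n. apply num_in_R, H.
Qed.

(** One unary predicate on R(κ) codes countably many ternary relations on it. *)
Lemma coded_extension κ α (T : nat -> V -> V -> V -> Prop) :
  unfoldable κ -> ordinal α ->
  exists X D X', pair_closed D /\ (forall x, in_R κ x -> D x) /\
    (forall β, β ∈ α -> D β) /\
    (forall n a b c, in_R κ a -> in_R κ b -> in_R κ c ->
      (decode X n a b c <-> T n a b c)) /\
    forall P, definable P -> forall e, (forall i, in_R κ (e i)) ->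
      (P (in_R κ) X e <-> P D X' e).
Proof.
  intros Hu Ha. assert (Hk := unfoldable_limit Hu).
  assert (HG := pair_closed_in_R Hk).
  destruct (in_R_set (proj1 Hk)) as [v Hv].
  destruct (separation (fun z => exists n a b c,
    is_quad z (num n) a b c /\ T n a b c) v) as [S HS].
  destruct (@transitive_extension _ κ S α Hu Ha) as (D & X' & Ht & Hsub & HD & Hel).
  { intros x Hx. apply Hv, HS, Hx. }
  assert (HGD : pair_closed D).
  { split; [exact Ht|split; [|intros n; apply Hsub, num_in_R, Hk]].
    set (pairs := All 0 (All 1 (Imp (All 2 (Imp
      (All 3 (Imp (Rel 3 2) (Imp (Imp (Eq 3 0) Bot) (Eq 3 1))))
      (Imp (Rel 0 2) (Imp (Rel 1 2) Bot)))) Bot))).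
    assert (H : sat (Structure D mem X') (fun _ => num 0) pairs).
    { apply Hel; [intros _; apply num_in_R, Hk|].
      intros a Ha' b Hb' N. destruct HG as (_ & HG & _).
      destruct (HG a b Ha' Hb') as (c & Hc & Hp). apply (N c Hc).
      - intros z _ Hz Hn. apply Hp in Hz as [Hz|Hz]; auto. destruct (Hn Hz).
      - apply Hp. auto.
      - apply Hp. auto. }
    intros a b Da Db. apply NNPP. intros N. apply (H a Da b Db).
    intros c Hc Hz H1 H2. apply N. exists c. split; auto. intros z. split.
    - intros Hzc. apply NNPP. intros N'. apply N'. right.
      apply (Hz z); auto. { exact (Ht _ _ Hc Hzc). }
    - intros [->| ->]; auto. }
  exists (fun x => x ∈ S), D, X'.
  split; [exact HGD|split; [exact Hsub|split; [exact HD|split]]].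
  - intros n a b c Ha' Hb Hc. split.
    + intros (z & Hz & Hs). apply HS in Hs as (_ & n' & a' & b' & c' & Hz' & HT).
      destruct (quad_injective Hz Hz') as (E & <- & <- & <-).
      apply num_injective in E. subst. exact HT.
    + intros HT. destruct (@quad_exists (in_R κ) (num n) a b c) as (z & Hz & Hq); auto.
      { apply num_in_R, Hk. }
      exists z. split; auto. apply HS. rewrite Hv. split; auto.
      exists n, a, b, c. auto.
  - intros P [φ Hφ] e He.
    rewrite <- (Hφ (in_R κ) _ HG e He).
    rewrite <- (Hφ D X' HGD e (fun i => Hsub _ (He i))). apply Hel, He.
Qed.
End Coding.

Section ConstructibleExtension.
Context {V : zfc_universe}.
Implicit Types (D X : V -> Prop) (e : nat -> V) (a b c κ α β δ w x : V).

(** The relations to be coded: 0 and 1 give the hierarchies R(a) and L_a, 2 gives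
    for each formula number b the subsets of L_a that it defines; the others are
    left open. *)
Definition hierarchies (T : nat -> V -> V -> V -> Prop) n a b c : Prop :=
  match n with
  | 0 => in_R a c
  | 1 => c ∈ L a
  | 2 => exists φ, b = num (code φ) /\ defined_by φ (L a) c
  | S (S (S n)) => T n a b c
  end.

Lemma definable_subset_iff (A x : V) :
  definable_subset A x <-> exists φ, defined_by φ A x.
Proof. unfold definable_subset, defined_by. firstorder. Qed.

Definition R_recursion : relation := fun D X (_ : nat -> V) =>
  forall α, D α -> ordinal α -> forall x, D x ->
  (decode X 0 α α x <->
   exists β, β ∈ α /\ forall y, y ∈ x -> decode X 0 β β y).

Lemma def_R_recursion : definable R_recursion.
Proof. unfold R_recursion. def; auto using def_ordinal, def_decode. Qed.

(** Transitive classes compute β ∈ α and y ∈ x correctly, so the recursion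
    determines relation 0. *)
Lemma R_recursion_correct D X e : pair_closed D -> R_recursion D X e ->
  forall α x, ordinal α -> D α -> D x -> (decode X 0 α α x <-> in_R α x).
Proof.
  intros (Ht & _) H α.
  induction α as [α IH] using (well_founded_ind mem_well_founded).
  intros x Ho Ha Hx. rewrite (H α Ha Ho x Hx), (in_R_recursion x Ho).
  split; intros (β & Hb & Hy); exists β; split; auto; intros y Hyx;
    apply (IH β Hb); eauto using ordinal_mem.
Qed.

(** The steps of the definition of L_α; entry 0 of the assignment is ω. *)
Definition L_recursion : relation := fun D X (e : nat -> V) =>
  forall α, D α -> ordinal α ->
  (exists A, D A /\ forall z, D z -> (z ∈ A <-> decode X 1 α α z)) /\
  (is_empty α -> forall x, D x -> ~ decode X 1 α α x) /\
  (limit α -> forall x, D x ->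
    (decode X 1 α α x <-> exists β, β ∈ α /\ decode X 1 β β x)) /\
  (forall β, β ∈ α -> is_succ β α -> forall x, D x ->
    (decode X 1 α α x <-> exists c, c ∈ e 0 /\ decode X 2 β c x)).

Lemma def_L_recursion : definable L_recursion.
Proof.
  unfold L_recursion. def;
    auto using def_ordinal, def_decode, def_is_empty, def_limit, def_is_succ.
Qed.

(** A separate relation for each external j, so that the right-hand side
    concerns at most one formula. *)
Definition defined_by_number j : relation := fun D X (_ : nat -> V) =>
  forall α, D α -> ordinal α -> forall A, D A ->
  (forall z, D z -> (z ∈ A <-> decode X 1 α α z)) -> forall x, D x ->
  (decode X 2 α (num j) x <-> exists φ, code φ = j /\ defined_by φ A x).

Lemma def_defined_by_number j : definable (defined_by_number j).
Proof.
  unfold defined_by_number. def_step. def_step; [apply def_ordinal|].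
  def_step. def_step; [def; apply def_decode|]. def_step. def_step.
  - apply def_at_num with (Q := fun D X e t => decode X 2 (e 2) t (e 0)).
    apply def_decode.
  - apply def_coded with (1 := code_injective) (P := fun φ D X e =>
        defined_by φ (e 1) (e 0)).
    intros φ. apply def_defined_by.
Qed.

(** Full separation by φ, which puts the definable subsets of an element of D
    into D. *)
Definition separates φ : relation := fun D _ (_ : nat -> V) =>
  forall e, (forall i, D (e i)) -> exists x, D x /\ (forall z, z ∈ x -> z ∈ e 0) /\
    forall y, y ∈ e 0 ->
    (y ∈ x <-> sat (mem_structure (e 0)) (upd (fun i => e (S i)) 0 y) φ).

Lemma def_separates φ : definable (separates φ).
Proof.
  assert (H := def_not (def_ex_tail 0 (def_not (def_separation (V := V) φ)))).
  revert H. apply def_equiv. intros D X _ e _. unfold separates. split.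
  - intros N f Hf. apply NNPP. intros N'. apply N. exists f.
    split; [|split]; auto. intros i Hi. lia.
  - intros H (f & Hf & _ & N). apply N, H, Hf.
Qed.

(** At a successor step, the left-hand side gives a formula number in ω, which is
    standard and hence belongs to a real formula; conversely, separation puts
    each definable subset into D. *)
Lemma L_recursion_correct D X e :
  pair_closed D -> (forall i, D (e i)) -> is_omega (e 0) ->
  L_recursion D X e -> (forall j, defined_by_number j D X e) ->
  (forall φ, separates φ D X e) ->
  forall α x, ordinal α -> D α -> ((D x /\ decode X 1 α α x) <-> x ∈ L α).
Proof.
  intros (Ht & _ & Hnum) He Hw HL Hdef Hsep α.
  induction α as [α IH] using (well_founded_ind mem_well_founded).
  intros x Ho Ha. destruct (HL α Ha Ho) as (_ & H0 & Hlim & Hsucc).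
  destruct (ordinal_cases Ho) as [H|[[β H]|H]].
  - split.
    + intros [Hx Hd]. destruct (H0 H x Hx Hd).
    + intros Hx. destruct (L_empty Ho H Hx).
  - assert (Hb : β ∈ α) by (apply H; auto).
    assert (Hbo := ordinal_mem Ho Hb). assert (Hbd := Ht _ _ Ha Hb).
    destruct (HL β Hbd Hbo) as ((A & HA & HAz) & _).
    assert (E : A = L β).
    { apply extensionality. intros z. rewrite <- (IH β Hb z Hbo Hbd). split.
      - intros Hz. assert (Hdz := Ht _ _ HA Hz). split; auto. apply HAz; auto.
      - intros [Hdz Hz]. apply HAz; auto. }
    rewrite (L_succ x Ho H), <- E, definable_subset_iff.
    assert (Hx : forall φ, defined_by φ A x -> D x).
    { intros φ [Hs (f & Hf & Hsat)].
      set (f' := fun i => if excluded_middle_informative (free i φ /\ i <> 0)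
                          then f i else A).
      destruct (Hsep φ (fun k => match k with 0 => A | S k => f' k end))
        as (x' & Hx' & Hs' & Hsat').
      { intros [|k]; auto. unfold f'.
        destruct (excluded_middle_informative _) as [[H1 H2]|_]; eauto. }
      replace x with x'; auto. apply extensionality. intros y.
      enough (HyA : y ∈ A -> (y ∈ x' <-> y ∈ x)).
      { split; intros Hy; apply HyA; auto. }
      intros Hy. rewrite (Hsat y Hy), (Hsat' y Hy). apply sat_ext.
      intros [|k] Hk; auto. change (f' (S k) = f (S k)). unfold f'.
      destruct (excluded_middle_informative (free (S k) φ /\ S k <> 0)) as [|N]; auto.
      destruct N. auto. }
    split.
    + intros [Hdx Hd]. apply (Hsucc β Hb H x Hdx) in Hd as (c & Hc & Hd).
      destruct (omega_standard Hw Hc) as [j ->].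
      apply (Hdef j β Hbd Hbo A HA HAz x Hdx) in Hd as (φ & _ & Hφ). eauto.
    + intros [φ Hφ]. assert (Hdx := Hx φ Hφ). split; auto.
      apply (Hsucc β Hb H x Hdx). exists (num (code φ)).
      split; [apply num_in_limit, Hw|].
      apply (Hdef _ β Hbd Hbo A HA HAz x Hdx). eauto.
  - rewrite (L_limit x H). split.
    + intros [Hx Hd]. apply (Hlim H x Hx) in Hd as (β & Hb & Hd). exists β.
      split; auto. apply (IH β Hb); eauto using ordinal_mem.
    + intros (β & Hb & Hx). apply (IH β Hb) in Hx; eauto using ordinal_mem.
      destruct Hx as [Hx Hd]. split; auto. apply (Hlim H x Hx). eauto.
Qed.

Lemma hierarchies_hold κ T X e : limit κ ->
  (forall n a b c, in_R κ a -> in_R κ b -> in_R κ c ->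
     (decode X n a b c <-> hierarchies T n a b c)) ->
  is_omega (e 0) ->
  R_recursion (in_R κ) X e /\ L_recursion (in_R κ) X e /\
  (forall j, defined_by_number j (in_R κ) X e) /\
  (forall φ, separates φ (in_R κ) X e).
Proof.
  intros Hk HX Hw. assert (Hko := proj1 Hk).
  assert (Ht : forall x y, in_R κ x -> y ∈ x -> in_R κ y)
    by (intros x y; apply in_R_transitive; exact Hko).
  assert (HLk : forall α, ordinal α -> in_R κ α -> in_R κ (L α)).
  { intros α Ho Ha. apply (in_R_ordinal κ Ho) in Ha.
    apply (in_R_step Hko Ha). intros y. apply L_in_R, Ho. }
  split; [|split; [|split]].
  - intros α Ha Ho x Hx. rewrite HX by auto. simpl.
    rewrite (in_R_recursion x Ho).
    split; intros (β & Hb & H); exists β; split; auto; intros y Hy;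
      specialize (H y Hy); apply HX in H || apply HX; eauto.
  - intros α Ha Ho. split; [|split; [|split]].
    + exists (L α). split; auto. intros z Hz. rewrite HX; auto. simpl. tauto.
    + intros He x Hx. rewrite HX; auto. apply L_empty; auto.
    + intros Hl x Hx. rewrite HX by auto. simpl. rewrite (L_limit x Hl).
      split; intros (β & Hb & H); exists β; split; auto;
        apply HX in H || apply HX; eauto.
    + intros β Hb Hs x Hx. assert (Hbk : in_R κ β) by eauto.
      rewrite HX by auto. simpl.
      rewrite (L_succ x Ho Hs), definable_subset_iff. split.
      * intros [φ Hφ]. exists (num (code φ)). split; [apply num_in_limit, Hw|].
        apply HX; auto using num_in_R. exists φ. auto.
      * intros (c & Hc & H). destruct (omega_standard Hw Hc) as [j ->].
        apply HX in H; auto using num_in_R. destruct H as (φ & _ & H). eauto.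
  - intros j α Ha Ho A HA HAz x Hx. rewrite HX by auto using num_in_R. simpl.
    assert (E : A = L α).
    { apply extensionality. intros z. split; intros Hz.
      - assert (Hzk := Ht _ _ HA Hz). apply HAz, HX in Hz; auto.
      - assert (Hzk := Ht _ _ (HLk _ Ho Ha) Hz).
        apply HAz, HX; auto. }
    rewrite E. split; intros (φ & Hj & H); exists φ; split; auto.
    apply num_injective in Hj. auto.
  - intros φ f Hf.
    destruct (separation (fun y => sat (mem_structure (f 0))
      (upd (fun i => f (S i)) 0 y) φ) (f 0)) as [x Hx].
    exists x. split; [|split].
    + assert (H := Hf 0). apply in_R_rank in H.
      apply (in_R_step Hko H). intros y Hy. apply in_R_rank, rank_mem.
      apply Hx, Hy.
    + intros z Hz. apply Hx, Hz.
    + intros y Hy. rewrite Hx. tauto.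
Qed.

(** Elementary extensions of R(κ) that contain the higher types over it and in
    which relation 0 still gives the hierarchy R(α). *)
Theorem constructible_extension κ n (T : nat -> V -> V -> V -> Prop) :
  V_equals_L V -> unfoldable κ ->
  exists X D X', pair_closed D /\ (forall x, in_R κ x -> D x) /\ D κ /\
    (forall k x, k < n -> type_dom (in_R κ) k x -> D x) /\
    (forall α x, ordinal α -> in_R κ α -> in_R κ x ->
       (decode X 0 α α x <-> in_R α x)) /\
    (forall α x, ordinal α -> D α -> D x -> (decode X' 0 α α x <-> in_R α x)) /\
    (forall i a b c, in_R κ a -> in_R κ b -> in_R κ c ->
      (decode X (3 + i) a b c <-> T i a b c)) /\
    forall P, definable P -> forall e, (forall i, in_R κ (e i)) ->
      (P (in_R κ) X e <-> P D X' e).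
Proof.
  intros HVL Hu. assert (Hk := unfoldable_limit Hu). assert (Hko := proj1 Hk).
  destruct (unfoldable_omega Hu) as (w & Hw & Hwk).
  destruct (@types_constructed_below V κ n HVL Hko) as (α & Ha & Hα).
  assert (exists τ, ordinal τ /\ κ ∈ τ /\ forall δ, δ ∈ α -> δ ∈ τ)
    as (τ & Hτ & Hkτ & Hατ).
  { destruct (ordinal_trichotomy Ha Hko) as [H|[H|H]].
    - exists (succ κ). split; [|split]; auto using ordinal_succ.
      + apply mem_succ. auto.
      + intros δ Hd. apply mem_succ. left. eapply ordinal_transitive; eauto.
    - subst α. exists (succ κ). split; [|split]; auto using ordinal_succ.
      + apply mem_succ. auto.
      + intros δ Hd. apply mem_succ. auto.
    - exists α. auto. }
  (* of height above κ and above all stages that construct higher types *)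
  destruct (coded_extension (hierarchies T) Hu Hτ)
    as (X & D & X' & HG & Hsub & Hord & HX & Hel).
  exists X, D, X'.
  assert (Hwe : forall i, in_R κ ((fun _ : nat => w) i)) by auto.
  destruct (hierarchies_hold Hk HX (e := fun _ => w) Hw) as (H1 & H2 & H3 & H4).
  apply (Hel _ def_R_recursion _ Hwe) in H1.
  apply (Hel _ def_L_recursion _ Hwe) in H2.
  assert (H3' : forall j, defined_by_number j D X' (fun _ => w)).
  { intros j. apply (Hel _ (def_defined_by_number j) _ Hwe), H3. }
  assert (H4' : forall φ, separates φ D X' (fun _ => w)).
  { intros φ. apply (Hel _ (def_separates φ) _ Hwe), H4. }
  split; [exact HG|split; [exact Hsub|split; [auto|split; [|split; [|split; [|split]]]]]].
  - intros k x Hlt Hx. destruct (Hα k x Hlt Hx) as (δ & Hd & Ho & Hxl).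
    apply (L_recursion_correct HG (e := fun _ => w) (X := X')) in Hxl; auto.
    apply Hxl.
  - intros β x Hb Hbk Hx. rewrite HX by auto. simpl. tauto.
  - exact (R_recursion_correct HG H1).
  - intros i a b c Ha' Hb Hc. rewrite HX by auto. simpl. tauto.
  - exact Hel.
Qed.
End ConstructibleExtension.

(** * Indescribability *)

Section Indescribable.
Context {V : zfc_universe}.
Implicit Types (D X : V -> Prop) (e : nat -> V) (κ α β : V).

Lemma matrix_mono n n' φ : n <= n' -> matrix n φ -> matrix n' φ.
Proof. intros Hn. induction φ; simpl; intuition lia. Qed.

Lemma prenex_matrix_above n q m φ : prenex n q m φ -> matrix (S n) φ.
Proof.
  induction 1 as [q φ H|q m i φ _ IH|q m i φ _ IH].
  - apply (matrix_mono (n := n)); auto.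
  - destruct q; simpl; auto.
  - destruct q; simpl; auto.
Qed.

(** Quantifiers over type n may belong to the matrix of a formula one order
    higher. *)
Lemma indescribable_above n m α : indescribable (S n) 0 α -> indescribable n m α.
Proof.
  intros [Hc H]. split; auto. intros U HU φ [Hp Hs]. apply H; auto.
  split; auto. apply prenex_matrix. eapply prenex_matrix_above; eauto.
Qed.

(** The statement that (R(α), ∈, U) satisfies the sentence φ, where U is the
    part in R(α) of the set coded at b; for a sentence any assignment will do. *)
Definition coded_models φ D X α b :=
  hsat_in D (coded_R D X α) (coded_U D X α b) (fun _ _ => α) φ.

Lemma def_coded_models φ i j :
  definable (fun D X e => coded_models φ D X (e i) (e j)).
Proof.
  exact (def_rename (fun k => match k with 0 => i | 1 => j | _ => i end)
           (def_hsat φ)).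
Qed.

(** Where D contains the higher types over R(α), it evaluates sentences in
    (R(α), ∈, U) correctly. *)
Lemma coded_models_iff D X α b (U : V -> Prop) n φ :
  (forall x, in_R α x -> D x) ->
  (forall x, D x -> (decode X 0 α α x <-> in_R α x)) ->
  (forall k x, k < n -> type_dom (in_R α) k x -> D x) ->
  (forall x, U x <-> in_R α x /\ decode X 3 b b x) ->
  matrix n φ -> sentence φ ->
  (coded_models φ D X α b <-> models (in_R α) U φ).
Proof.
  intros HD HR Ht HU Hm Hs. unfold coded_models.
  assert (E : forall x, coded_R D X α x <-> in_R α x).
  { intros x. unfold coded_R. split.
    - intros [Hx H]. apply HR; auto.
    - intros Hx. split; auto. apply HR; auto. }
  rewrite (@hsat_in_iff V D (coded_R D X α) (coded_U D X α b) (in_R α) U n φ _ E);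
    auto.
  - split; [apply sentence_models, Hs|auto].
  - intros x. rewrite HU. unfold coded_U. rewrite E. tauto.
Qed.

(** In an extension D that contains the higher types, κ witnesses that some R(α)
    satisfies φ together with U; elementarity finds such an α below κ. *)
Lemma reflection κ n (U : V) φ :
  V_equals_L V -> unfoldable κ -> (forall x, x ∈ U -> in_R κ x) ->
  matrix n φ -> sentence φ -> models (in_R κ) (fun x => x ∈ U) φ ->
  exists α, α ∈ κ /\ ~ is_empty α /\
    models (in_R α) (fun x => x ∈ U /\ in_R α x) φ.
Proof.
  intros HVL Hu HU Hm Hs Hφ.
  assert (Hk := unfoldable_limit Hu). assert (Hko := proj1 Hk).
  destruct (constructible_extension n (fun _ _ _ c => c ∈ U) HVL Hu)
    as (X & D & X' & HG & Hsub & HDk & Htyp & HR & HR' & HX & Hel).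
  assert (H0 : in_R κ (num 0)) by apply num_in_R, Hk.
  set (P := fun D X (e : nat -> V) => exists α, D α /\
    (ordinal α /\ ~ is_empty α) /\ coded_models φ D X α (e 0)).
  assert (HP : definable P).
  { unfold P. def; auto using def_ordinal, def_is_empty, def_coded_models. }
  assert (H : P D X' (fun _ => num 0)).
  { exists κ. split; auto. split; [split; [exact Hko|apply Hk]|].
    apply (coded_models_iff (U := fun x => x ∈ U) (n := n)); auto.
    intros x. split; [intros Hx; split; auto|intros [Hx Hd]].
    - apply (Hel _ (def_decode 3 0 0 1) (fun i => match i with 0 => num 0 | _ => x end)).
      + intros [|i]; auto.
      + apply (HX 0); auto.
    - apply (Hel _ (def_decode 3 0 0 1) (fun i => match i with 0 => num 0 | _ => x end))
        in Hd.
      + apply (HX 0) in Hd; auto.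
      + intros [|i]; auto. }
  apply (Hel _ HP) in H; auto.
  destruct H as (α & Ha & (Ho & Hne) & H).
  assert (Hak := proj1 (in_R_ordinal κ Ho) Ha).
  exists α. split; [exact Hak|split; [exact Hne|]]. revert H.
  apply (coded_models_iff (n := n)); auto.
  - intros x. apply in_R_mono; auto.
  - intros k x _. apply type_dom_in_R; auto.
  - intros x. split; intros [H1 H2]; split; auto.
    + apply (HX 0); auto.
    + apply (HX 0) in H2; auto. eapply in_R_mono; eauto.
Qed.

Definition counterexample n α (U : V) φ :=
  (forall x, x ∈ U -> in_R α x) /\ matrix n φ /\ sentence φ /\
  models (in_R α) (fun x => x ∈ U) φ /\
  forall β, β ∈ α -> ~ is_empty β ->
    ~ models (in_R β) (fun x => x ∈ U /\ in_R β x) φ.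

Lemma counterexample_exists n α :
  cardinal α -> ~ indescribable n 0 α -> exists U φ, counterexample n α U φ.
Proof.
  intros Hc H. apply NNPP. intros N. apply H. split; auto.
  intros U HU φ [Hp Hs] Hm. apply NNPP. intros N'. apply N. exists U, φ.
  split; [|split; [|split; [|split]]]; auto.
  - inversion Hp; auto.
  - intros β Hb Hne Hbm. apply N'. exists β. auto.
Qed.

Lemma collapsing_map_exists α : ordinal α -> ~ cardinal α ->
  exists β (f : V -> V), β ∈ α /\ forall y, y ∈ α -> exists x, x ∈ β /\ f x = y.
Proof.
  intros Ho H. apply NNPP. intros N. apply H. split; auto.
  intros β Hb (f & _ & _ & Hf). apply N. exists β, f. auto.
Qed.

(** Relation 5 at α is a map onto α from a smaller ordinal when α is not a
    cardinal, and relation 4 at α gives the number of a sentence that refutes the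
    indescribability of α otherwise; entry 0 of the assignment is ω. *)
Definition failure_recorded : relation := fun D X (e : nat -> V) =>
  forall α, D α -> ordinal α ->
    (exists β, β ∈ α /\ (forall y, y ∈ α -> exists x, x ∈ β /\ decode X 5 α x y) /\
      forall x, D x -> forall y, D y -> forall y', D y' ->
        decode X 5 α x y -> decode X 5 α x y' -> y = y') \/
    exists c, c ∈ e 0 /\ decode X 4 α c c.

Lemma def_failure_recorded : definable failure_recorded.
Proof. unfold failure_recorded. def; auto using def_ordinal, def_decode. Qed.

(** Together with the set given by relation 3, the sentence number j is a
    counterexample wherever relation 4 uses it. *)
Definition failure_by_number n j : relation := fun D X (_ : nat -> V) =>
  forall α, D α -> ordinal α -> decode X 4 α (num j) (num j) ->
  exists φ, hcode φ = j /\ (matrix n φ /\ sentence φ) /\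
    coded_models φ D X α α /\
    forall β, β ∈ α -> ~ is_empty β -> ~ coded_models φ D X β α.

Lemma def_failure_by_number n j : definable (failure_by_number n j).
Proof.
  unfold failure_by_number. def_step. def_step; [apply def_ordinal|].
  apply def_imp.
  - apply def_at_num with (Q := fun D X e t => decode X 4 (e 0) t t).
    apply def_decode.
  - apply def_coded with (1 := hcode_injective) (P := fun φ D X e =>
      (matrix n φ /\ sentence φ) /\ coded_models φ D X (e 0) (e 0) /\
      forall β, β ∈ e 0 -> ~ is_empty β -> ~ coded_models φ D X β (e 0)).
    intros φ. def; auto using def_is_empty, def_coded_models.
Qed.

Lemma no_surjection_onto_regular κ β (R : V -> V -> Prop) :
  regular κ -> β ∈ κ ->
  (forall y, y ∈ κ -> exists x, x ∈ β /\ R x y) ->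
  (forall x y y', x ∈ β -> y ∈ κ -> y' ∈ κ -> R x y -> R x y' -> y = y') -> False.
Proof.
  intros [Hk Hreg] Hb Hsurj Hfun.
  destruct (@choose_function V (fun x => x ∈ β)
    (fun x y => y ∈ κ /\ forall y', y' ∈ κ -> R x y' -> y' = y)) as [f Hf].
  { intros x Hx. destruct (classic (exists y, y ∈ κ /\ R x y)) as [(y & Hy & Hr)|N].
    - exists y. split; auto. intros y' Hy' Hr'. eauto.
    - exists (num 0). split; [apply num_in_limit, Hk|].
      intros y' Hy' Hr. destruct N. eauto. }
  destruct (Hreg β f Hb) as (δ & Hd & Hlt).
  { intros ξ Hx. apply (Hf ξ Hx). }
  destruct (Hsurj δ Hd) as (x & Hx & Hr).
  assert (Hl := Hlt x Hx). rewrite <- (proj2 (Hf x Hx) δ Hd Hr) in Hl.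
  exact (mem_irrefl Hl).
Qed.

(** Recorded counterexamples for all cardinals below κ extend to one for κ in D,
    which [reflection] contradicts. *)
Theorem unfoldable_above_indescribable κ n :
  V_equals_L V -> unfoldable κ -> exists α, α ∈ κ /\ indescribable n 0 α.
Proof.
  intros HVL Hu. apply NNPP. intros N.
  assert (Hk := unfoldable_limit Hu). assert (Hko := proj1 Hk).
  assert (Hreg : regular κ) by apply Hu.
  assert (Hin : forall α, ordinal α -> in_R κ α -> α ∈ κ).
  { intros α Ho. apply in_R_ordinal, Ho. }
  assert (exists c : V -> V * hformula, forall α, cardinal α -> α ∈ κ ->
            counterexample n α (fst (c α)) (snd (c α))) as [c Hc].
  { exists (fun α => epsilon (inhabits (num 0, HBot))
      (fun p => counterexample n α (fst p) (snd p))).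
    intros α Ha Hak. apply epsilon_spec.
    destruct (@counterexample_exists n α Ha) as (U & φ & H); eauto.
    exists (U, φ). exact H. }
  assert (exists g : V -> V * (V -> V), forall α, ordinal α -> ~ cardinal α ->
    fst (g α) ∈ α /\ forall y, y ∈ α -> exists x, x ∈ fst (g α) /\ snd (g α) x = y)
    as [g Hg].
  { exists (fun α => epsilon (inhabits (num 0, fun x => x))
      (fun p : V * (V -> V) => fst p ∈ α /\
        forall y, y ∈ α -> exists x, x ∈ fst p /\ snd p x = y)).
    intros α Ha Hn. apply epsilon_spec.
    destruct (collapsing_map_exists Ha Hn) as (β & f & H). exists (β, f). exact H. }
  (* these become the relations 3, 4 and 5 *)
  set (T := fun (i : nat) (a b x : V) => match i with
    | 0 => x ∈ fst (c a)
    | 1 => cardinal a /\ b = num (hcode (snd (c a)))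
    | _ => x = snd (g a) b
    end).
  destruct (constructible_extension n T HVL Hu)
    as (X & D & X' & HG & Hsub & HDk & Htyp & HR & HR' & HX & Hel).
  destruct (unfoldable_omega Hu) as (w & Hw & Hwk).
  assert (H1 : failure_recorded (in_R κ) X (fun _ => w)).
  { intros α Ha Ho. destruct (classic (cardinal α)) as [Hca|Hca].
    - right. exists (num (hcode (snd (c α)))).
      split; [apply num_in_limit, Hw|]. apply (HX 1); auto using num_in_R.
      split; auto.
    - left. destruct (Hg α Ho Hca) as [Hb Hs]. exists (fst (g α)).
      split; [exact Hb|split].
      + intros y Hy. destruct (Hs y Hy) as (x & Hx & <-). exists x. split; auto.
        assert (H : in_R κ (fst (g α))) by (eapply in_R_transitive; eauto).
        apply (HX 2); auto; [| |reflexivity].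
        * exact (in_R_transitive Hko H Hx).
        * exact (in_R_transitive Hko Ha Hy).
      + intros x Hx y Hy y' Hy' E E'. apply (HX 2) in E, E'; auto.
        unfold T in E, E'. congruence. }
  assert (H2 : forall j, failure_by_number n j (in_R κ) X (fun _ => w)).
  { intros j α Ha Ho Hj. apply (HX 1) in Hj; auto using num_in_R.
    destruct Hj as [Hca Hj]. apply num_injective in Hj.
    assert (Hak := Hin α Ho Ha).
    destruct (Hc α Hca Hak) as (HU & Hm & Hs & Hmod & Hno).
    exists (snd (c α)). split; [auto|split; [auto|split]].
    - revert Hmod. apply (coded_models_iff (n := n)); auto.
      + intros x. apply in_R_mono; auto.
      + intros k x _. apply type_dom_in_R; auto.
      + intros x. split.
        * intros Hx. assert (Hr := HU x Hx). split; auto. apply (HX 0); auto.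
          eapply in_R_mono; eauto.
        * intros [Hr Hx]. apply (HX 0) in Hx; auto. eapply in_R_mono; eauto.
    - intros β Hb Hne Hm'. apply (Hno β Hb Hne). revert Hm'.
      assert (Hbk : in_R κ β) by (eapply in_R_transitive; eauto).
      assert (Hbo := ordinal_mem Ho Hb).
      assert (Hmono : forall x, in_R β x -> in_R κ x).
      { intros x. apply in_R_mono; auto. }
      apply (coded_models_iff (n := n)); auto.
      + intros k x _. apply type_dom_in_R; auto.
      + intros x. split.
        * intros [Hx Hr]. split; auto. apply (HX 0); auto.
        * intros [Hr Hx]. split; auto. apply (HX 0) in Hx; auto. }
  apply (Hel _ def_failure_recorded (fun _ => w)) in H1; auto.
  assert (H2' : forall j, failure_by_number n j D X' (fun _ => w)).
  { intros j. apply (Hel _ (def_failure_by_number n j)); auto. }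
  assert (Hord : forall α, α ∈ κ -> in_R κ α).
  { intros α Ha. apply in_R_ordinal; auto. eapply ordinal_mem; eauto. }
  destruct (H1 κ HDk Hko) as [(β & Hb & Hs & Hf)|(d & Hd & H4)].
  - apply (@no_surjection_onto_regular κ β (decode X' 5 κ) Hreg Hb Hs).
    intros x y y' Hx Hy Hy'. assert (Hxk := ordinal_transitive Hko Hb Hx).
    apply Hf; auto.
  - destruct (omega_standard Hw Hd) as [j ->].
    destruct (H2' j κ HDk Hko H4) as (φ & _ & (Hm & Hs) & Hmod & Hno).
    destruct (in_R_set Hko) as [v Hv].
    destruct (separation (decode X' 3 κ κ) v) as [U HU].
    assert (HUk : forall x, x ∈ U <-> in_R κ x /\ decode X' 3 κ κ x).
    { intros x. rewrite HU, Hv. tauto. }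
    destruct (@reflection κ n U φ) as (α & Ha & Hne & Hα); auto.
    + intros x Hx. apply HUk, Hx.
    + revert Hmod. apply (coded_models_iff (n := n)); auto.
    + apply (Hno α Ha Hne). revert Hα.
      apply (coded_models_iff (n := n)); auto.
      * intros x Hx. apply Hsub. eapply in_R_mono; eauto.
      * intros x Hx. apply HR'; auto. eapply ordinal_mem; eauto.
      * intros k x _ Hx. apply Hsub. eapply type_dom_in_R; eauto.
      * intros x. rewrite HUk.
        enough (in_R α x -> in_R κ x) by tauto. apply in_R_mono; auto.
Qed.
End Indescribable.

Unset Implicit Arguments.

Theorem corollary3p2 (V : zfc_universe) :
  V_equals_L V ->
  (exists κ : V, unfoldable κ) ->
  (exists θ : V, subtle θ) ->
  exists κ : V, least unfoldable κ /\
    forall n m : nat, exists π : V, first_indescribable n m π /\ π ∈ κ.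
Proof.
  intros HVL Hu _. destruct (minimal_element Hu) as (κ & Hκ & Hmin).
  exists κ. split; [split; auto|]. intros n m.
  destruct (unfoldable_above_indescribable (S n) HVL Hκ) as (α & Ha & Hi).
  destruct (@minimal_element V (fun π => π ∈ κ /\ indescribable n m π))
    as (π & [Hπ Hπi] & Hπmin).
  { exists α. split; auto. apply indescribable_above, Hi. }
  exists π. split; auto. split; auto. intros β Hb Hβ.
  apply (Hπmin β Hb). split; auto.
  apply (ordinal_transitive (proj1 (unfoldable_limit Hκ)) Hπ Hb).
Qed.
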